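(* Let $B$ be an $n$-dimensional Riemannian manifold ($n\ge1$) and let $M$ be a compact, orientable $(n+1)$-dimensional semi-Riemannian manifold of index $1$. Then there is no semi-Riemannian submersion $\pi:M\to B$ with positive mixed curvature, i.e. such that $K(X,V)>0$ for every nonzero horizontal vector $X$ and every nonzero vertical vector $V$ at the same point of $M$.
   Context: All manifolds are smooth and connected. A semi-Riemannian submersion $\pi:(M,g)\to(B,g')$ between semi-Riemannian manifolds is a smooth surjective map such that $\pi_*$ is onto at every point, the fibres $\pi^{-1}(b)$ are semi-Riemannian (nondegenerate) submanifolds of $M$, and $\pi_*$ preserves scalar products of vectors normal to fibres; fibres are assumed connected. Vectors tangent to fibres are vertical, vectors normal to fibres are horizontal. Sectional curvature: $R(E,F)G=\nabla_E\nabla_FG-\nabla_F\nabla_EG-\nabla_{[E,F]}G$, and for a nondegenerate plane spanned by $X,V$, $K(X,V)=\dfrac{g(R(X,V)V,X)}{g(X,X)g(V,V)-g(X,V)^2}$. The mixed sectional curvature is $K(X,V)$ with $X$ horizontal and $V$ vertical. *)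

(* Defs.v *)
From HB Require Import structures.
From mathcomp Require Export all_boot all_order all_algebra.
From mathcomp Require Export all_classical all_reals all_analysis.
Export numFieldNormedType.Exports.
Set Implicit Arguments.
Unset Strict Implicit.
Unset Printing Implicit Defensive.
Import Order.TTheory GRing.Theory Num.Theory.
Local Open Scope classical_set_scope.
Local Open Scope ring_scope.

(* Vectors are row vectors; in accordance with the library's Jacobian, the    *)
(* differential of f at x maps u to u *m 'J f x. A tangent vector of a        *)
(* manifold at p is represented by its components u : 'rV_n in a chart c      *)
(* around p; every pointwise notion below is quantified over all such charts. *)

Section Smoothness.
Variable R : realType.

(* Only meant for an open set U. *)
Fixpoint Ck (k : nat) (n : nat) (V : normedModType R) (U : set 'rV[R]_n)
    (f : 'rV[R]_n -> V) : Prop :=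
  (forall x, U x -> {for x, continuous f}) /\
  (if k is k'.+1 then
     forall i : 'I_n,
       (forall x, U x -> derivable f x (delta_mx 0 i)) /\
       Ck k' U ('D_(delta_mx 0 i) f)
   else True).

Definition smooth_on n (V : normedModType R) (U : set 'rV[R]_n)
    (f : 'rV[R]_n -> V) : Prop :=
  forall k, Ck k U f.

End Smoothness.

Section Manifolds.
Variable R : realType.

(* The maps cto and cfrom are total functions, but their values are only      *)
(* relevant on cdom and cimg respectively.                                    *)
Record chart (T : topologicalType) (n : nat) := Chart {
  cdom : set T;
  cimg : set 'rV[R]_n;
  cto : T -> 'rV[R]_n;
  cfrom : 'rV[R]_n -> T;
  open_cdom : open cdom;
  open_cimg : open cimg;
  cto_img : forall p, cdom p -> cimg (cto p);
  cfrom_dom : forall x, cimg x -> cdom (cfrom x);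
  ctoK : forall p, cdom p -> cfrom (cto p) = p;
  cfromK : forall x, cimg x -> cto (cfrom x) = x;
  cto_continuous : forall p, cdom p -> {for p, continuous cto};
  cfrom_continuous : forall x, cimg x -> {for x, continuous cfrom}
}.

Definition overlap (T : topologicalType) n (c d : chart T n) : set 'rV[R]_n :=
  cto c @` (cdom c `&` cdom d).

Definition transition (T : topologicalType) n (c d : chart T n) :
    'rV[R]_n -> 'rV[R]_n :=
  cto d \o cfrom c.

Definition compatible (T : topologicalType) n (c d : chart T n) : Prop :=
  smooth_on (overlap c d) (transition c d) /\
  smooth_on (overlap d c) (transition d c).

Definition covers (T : topologicalType) n (A : set (chart T n)) : Prop :=
  forall p : T, exists2 c, A c & cdom c p.

(* Non-emptiness is required separately, because the library's [connected]    *)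
(* holds of the empty set.                                                    *)
Record manifold (n : nat) := Manifold {
  mcarrier :> topologicalType;
  atlas : set (chart mcarrier n);
  mfd_hausdorff : hausdorff_space mcarrier;
  mfd_second_countable : @second_countable mcarrier;
  mfd_nonempty : [set: mcarrier] !=set0;
  mfd_connected : connected [set: mcarrier];
  atlas_covers : covers atlas;
  atlas_compatible : forall c d, atlas c -> atlas d -> compatible c d
}.

Definition chart_at n (M : manifold n) (c : chart M n) (p : M) : Prop :=
  atlas c /\ cdom c p.

Definition orientable n (M : manifold n) : Prop :=
  exists O : set (chart M n),
    [/\ covers O,
        forall c d, O c -> atlas d -> compatible c d,
        forall c d, O c -> O d -> compatible c d &
        forall c d x, O c -> O d -> overlap c d x ->
          0 < \det ('J (transition c d) x)].

Definition local_rep m n (M : manifold m) (N : manifold n) (f : M -> N)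
    (c : chart M m) (d : chart N n) : 'rV[R]_m -> 'rV[R]_n :=
  cto d \o f \o cfrom c.

Definition smooth_map m n (M : manifold m) (N : manifold n) (f : M -> N) :
    Prop :=
  continuous f /\
  forall (c : chart M m) (d : chart N n), atlas c -> atlas d ->
    smooth_on (cto c @` (cdom c `&` f @^-1` cdom d)) (local_rep f c d).

End Manifolds.

Section Metrics.
Variable R : realType.

Definition bilin n (A : 'M[R]_n) (u v : 'rV[R]_n) : R := (u *m A *m v^T) 0 0.

(* The maximal dimension of a subspace on which the form is negative          *)
(* definite; subspaces are row spaces of matrices.                            *)
Definition has_index n (A : 'M[R]_n) (nu : nat) : Prop :=
  let negative_definite (W : 'M[R]_n) :=
    forall u : 'rV[R]_n, (u <= W)%MS -> u != 0 -> bilin A u u < 0 in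
  (exists2 W : 'M[R]_n, negative_definite W & \rank W = nu) /\
  (forall W : 'M[R]_n, negative_definite W -> (\rank W <= nu)%N).

(* A semi-Riemannian metric, given by its matrix of components                *)
(* g(d_i, d_j) in every chart of the atlas.                                   *)
Record metric n (M : manifold R n) := Metric {
  gmx : chart R M n -> 'rV[R]_n -> 'M[R]_n;
  gmx_smooth : forall c, atlas c -> smooth_on (cimg c) (gmx c);
  gmx_sym : forall c x, atlas c -> cimg c x -> (gmx c x)^T = gmx c x;
  gmx_nondegenerate :
    forall c x, atlas c -> cimg c x -> gmx c x \in unitmx;
  gmx_transition : forall c d x, atlas c -> atlas d -> overlap c d x ->
    gmx c x = 'J (transition c d) x *m gmx d (transition c d x)
                *m ('J (transition c d) x)^T
}.

Definition metric_at n (M : manifold R n) (g : metric M) (c : chart R M n)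
    (p : M) (u v : 'rV[R]_n) : R :=
  bilin (gmx g c (cto c p)) u v.

Definition riemannian n (M : manifold R n) (g : metric M) : Prop :=
  forall c p, chart_at c p ->
  forall u, u != 0 -> 0 < metric_at g c p u u.

Definition metric_index n (M : manifold R n) (g : metric M) (nu : nat) :
    Prop :=
  forall c p, chart_at c p -> has_index (gmx g c (cto c p)) nu.

End Metrics.

Section Curvature.
Variables (R : realType) (n : nat).

(* G is the component matrix of a metric in a chart, and vector fields on     *)
(* the image of the chart are functions from 'rV_n to 'rV_n.                  *)
Variable G : 'rV[R]_n -> 'M[R]_n.
Implicit Types (E F H : 'rV[R]_n -> 'rV[R]_n) (x u v w : 'rV[R]_n).

Definition partial_g x (l i j : 'I_n) : R := ('D_(delta_mx 0 l) G x) i j.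

(* Christoffel symbol of the second kind, with upper index k. *)
Definition christoffel x (k i j : 'I_n) : R :=
  2^-1 * \sum_l invmx (G x) k l *
    (partial_g x i j l + partial_g x j i l - partial_g x l i j).

(* The Levi-Civita connection. *)
Definition nabla E F : 'rV[R]_n -> 'rV[R]_n := fun x =>
  'D_(E x) F x +
  \row_k \sum_i \sum_j christoffel x k i j * E x 0 i * F x 0 j.

Definition lie_bracket E F : 'rV[R]_n -> 'rV[R]_n := fun x =>
  'D_(E x) F x - 'D_(F x) E x.

Definition curvature E F H : 'rV[R]_n -> 'rV[R]_n := fun x =>
  nabla E (nabla F H) x - nabla F (nabla E H) x
  - nabla (lie_bracket E F) H x.

(* The curvature being tensorial, R(u, v)w at x is computed by extending      *)
(* u, v, w to vector fields with constant components.                         *)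
Definition curvature_at x u v w : 'rV[R]_n :=
  curvature (cst u) (cst v) (cst w) x.

Definition sectional x u v : R :=
  bilin (G x) (curvature_at x u v v) u /
  (bilin (G x) u u * bilin (G x) v v - bilin (G x) u v ^+ 2).

End Curvature.

Section Submersions.
Variables (R : realType) (m n : nat) (M : manifold R m) (B : manifold R n).
Variables (gM : metric M) (gB : metric B) (pi : M -> B).

Definition differential (c : chart R M m) (d : chart R B n) (p : M)
    (u : 'rV[R]_m) : 'rV[R]_n :=
  u *m 'J (local_rep pi c d) (cto c p).

(* The tangent space of the fibre through p is the kernel of the              *)
(* differential of pi at p.                                                   *)
Definition vertical (c : chart R M m) (p : M) (u : 'rV[R]_m) : Prop :=
  forall d : chart R B n, chart_at d (pi p) -> differential c d p u = 0.

Definition horizontal (c : chart R M m) (p : M) (u : 'rV[R]_m) : Prop :=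
  forall v, vertical c p v -> metric_at gM c p u v = 0.

Record semi_riemannian_submersion : Prop := SemiRiemannianSubmersion {
  subm_smooth : smooth_map pi;
  subm_surjective : forall b : B, exists p : M, pi p = b;
  subm_differential_onto : forall c d p, chart_at c p -> chart_at d (pi p) ->
    forall w, exists u, differential c d p u = w;
  subm_fibre_connected : forall b : B, connected (pi @^-1` [set b]);
  subm_fibre_nondegenerate : forall c p, chart_at c p ->
    forall u, vertical c p u ->
      (forall v, vertical c p v -> metric_at gM c p u v = 0) -> u = 0;
  subm_isometry : forall c d p, chart_at c p -> chart_at d (pi p) ->
    forall u v, horizontal c p u -> horizontal c p v ->
      metric_at gB d (pi p) (differential c d p u) (differential c d p v) =
      metric_at gM c p u v
}.

Definition positive_mixed_curvature : Prop :=
  forall c p, chart_at c p ->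
  forall X V, horizontal c p X -> vertical c p V -> X != 0 -> V != 0 ->
    0 < sectional (gmx gM c) (cto c p) X V.

End Submersions.

(* Main.v *)
From HB Require Import structures.
Require Import Defs.
From mathcomp Require Import ring.
Set Implicit Arguments.
Unset Strict Implicit.
Unset Printing Implicit Defensive.
Import Order.TTheory GRing.Theory Num.Theory.
Local Open Scope classical_set_scope.
Local Open Scope ring_scope.

(** Let V be a local unit vertical field. The fibres are one-dimensional; as the
    base is Riemannian and M has index 1, they are timelike, so <V, V> = -1 and
    the horizontal vectors are spacelike. The acceleration N = nabla_V V of the
    fibres is horizontal and does not change when V is replaced by -V. Let X be
    a basic field, i.e. the horizontal lift of a field of the base; then [X, V]
    is vertical and <X, X> is constant along the fibres, and one computes
    ([mixed_curvatureE])

      <R(X, V)V, X> = <nabla_X N, X> + <nabla_X V, nabla_X V> + <N, X>^2.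

    The vector nabla_X V is orthogonal to V, hence spacelike, and the last two
    terms are nonnegative. Positive mixed curvature means that the left-hand side
    is negative for X <> 0, since <V, V> < 0. So <nabla_X N, X> < 0 for all basic
    X <> 0.

    Now <N, N> attains its maximum on the compact manifold M at some point p. If
    N(p) <> 0, choose X with X(p) = N(p): at p the number 2 <nabla_X N, X> is the
    derivative of <N, N> along N, which is 0. If N(p) = 0, then <N, N> <= 0
    everywhere, N vanishes identically and <nabla_X N, X> = 0 for every X. Both
    cases are contradictory ([accel_max_impossible]).

    It remains to see that <N, N> is a function on M, although it is computed in
    charts and with local fields V. The projection of N to the base is the value
    on (V, V) of minus the second fundamental form of the submersion
    ([fibre_accel]); it depends on V at the point only, is even in V, and is
    compatible with changes of charts ([fibre_accel_transition],
    [accel_sq_invariant]). Since the submersion is isometric on horizontal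
    vectors, the square norm of this projection is <N, N>
    ([field_accel_norm]).

    In charts the whole submersion enters through one relation between the
    Jacobian J of the map and the matrices G, h of the two metrics,
    J^T G^-1 J h = 1 ([submersion_cometric]); it provides horizontal lifts and
    vertical projections by explicit, hence smooth, formulas. The calculus needed
    is the chain rule, for which functions with continuous partial derivatives
    must be seen to be differentiable ([differentiable_of_partials]), and the
    symmetry of second derivatives ([derive_comm]). *)

(** * Calculus of real functions on row vectors *)

Section Differentiability.
Variables (R : realType).

Lemma differentiable_of_eps (V W : normedModType R) (f : V -> W)
    (df : {linear V -> W}) (x : V) :
  continuous df ->
  (forall e : R, 0 < e -> \forall h \near (0 : V),
     `|f (h + x) - f x - df h| <= e * `|h|) ->
  differentiable f x.
Proof.
move=> dfc fE.
have fxo : f \o shift x = cst (f x) + df +o_ 0 id.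
  apply/eqaddoP => _ /posnumP[e]; near=> h.
  rewrite /= opprD addrA -![(_ - _) _]/(_ - _) /cst/=.
  by near: h; exact: fE.
by apply/diff_locallyP; rewrite (diff_unique dfc fxo).
Unshelve. all: by end_near. Qed.

Lemma near_eq_differentiable (V W : normedModType R) (f g : V -> W) (x : V) :
  (\near x, f x = g x) -> differentiable f x -> differentiable g x.
Proof.
move=> fg df.
have [dfc /eqaddoP fo] := (diff_locallyP _ _).1 df.
apply: (@differentiable_of_eps _ _ g ('d f x) x dfc) => e e0.
have fgx : f x = g x := nbhs_singleton fg.
have fgh : \forall h \near (0 : V), f (h + x) = g (h + x).
  by have := fg; rewrite (near_shift (0:V) x) /= subr0.
near=> h.
have <- : f (h + x) = g (h + x) by near: h.
rewrite -fgx.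
have : `|(f \o shift x - (cst (f x) + 'd f x)) h| <= e * `|h|.
  by near: h; exact: fo.
by rewrite -[X in X -> _]/(is_true (`|f (h + x) - (f x + 'd f x h)| <= _)) opprD addrA.
Unshelve. all: by end_near. Qed.

Lemma differentiable_entries (V : normedModType R) p q (F : V -> 'M[R]_(p, q)) x :
  (forall i j, differentiable (fun y => F y i j : R) x) -> differentiable F x.
Proof.
move=> Fd.
have -> : F = fun y => \sum_(k < p * q) (mxvec (F y) 0 k *: vec_mx (delta_mx 0 k)).
  apply/funext => y; rewrite -[LHS]mxvecK [in LHS](row_sum_delta (mxvec (F y))).
  by rewrite linear_sum; apply: eq_bigr => k _; rewrite linearZ.
rewrite (_ : (fun y => _) = \sum_(k < p * q) fun y =>
    mxvec (F y) 0 k *: (vec_mx (delta_mx 0 k) : 'M[R]_(p, q))); last first.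
  by apply/funext => y; rewrite fct_sumE.
apply: differentiable_sum => k; apply: differentiableZl.
case/mxvec_indexP: k => i j.
rewrite (_ : (fun y => _) = fun y => F y i j); first exact: Fd.
by apply/funext => y; rewrite mxvecE.
Qed.

Lemma differentiable_entry (V : normedModType R) p q (F : V -> 'M[R]_(p, q)) x i j :
  differentiable F x -> differentiable (fun y => F y i j : R) x.
Proof.
move=> dF; apply: (@differentiable_comp _ _ _ _ F (fun N : 'M[R]_(p, q) => N i j : R)) => //.
exact: differentiable_coord.
Qed.

End Differentiability.

Section MeanValue.
Variables (R : realType) (V : normedModType R).
Implicit Types (f : V -> R) (x v : V).

Lemma is_derive_line f x v (t : R) : derivable f (t *: v + x) v ->
  is_derive t (1 : R) (fun s : R => f (s *: v + x)) ('D_v f (t *: v + x)).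
Proof.
move=> fd.
have E : (fun h : R => h^-1 *:
         (((fun s : R => f (s *: v + x)) \o shift t) (h *: (1 : R)) - f (t *: v + x)))
       = (fun h : R => h^-1 *: ((f \o shift (t *: v + x)) (h *: v) - f (t *: v + x))).
  by apply/funext => h /=; rewrite [_%:A]mulr1 scalerDl addrA.
by split; rewrite /derivable /derive /= E.
Qed.

Lemma mean_value_line f x v (a : R) :
  (forall t : R, `|t| <= `|a| -> derivable f (t *: v + x) v) ->
  exists2 t : R, `|t| <= `|a| & f (a *: v + x) - f x = a * 'D_v f (t *: v + x).
Proof.
move=> fd; pose g (s : R) := f (s *: v + x).
have gd (t : R) : `|t| <= `|a| -> is_derive t (1 : R) g ('D_v f (t *: v + x)).
  by move=> ta; apply: is_derive_line; exact: fd.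
have g0 : f x = g 0 by rewrite /g scale0r add0r.
rewrite g0 -/(g a).
case: (leP 0 a) => a0.
- have ta (t : R) : t \in `[0, a] -> `|t| <= `|a|.
    by rewrite in_itv /= => /andP[t0 t1]; rewrite !ger0_norm.
  have [||c cI] := @MVT_segment R g (fun t : R => 'D_v f (t *: v + x)) 0 a a0.
  + by move=> t tI; apply: gd; apply: ta; exact: subset_itv_oo_cc tI.
  + by apply: derivable_within_continuous => t tI; apply: ex_derive; apply: gd; exact: ta.
  by rewrite subr0 mulrC => gE; exists c => //; exact: ta.
- have ta (t : R) : t \in `[a, 0] -> `|t| <= `|a|.
    rewrite in_itv /= => /andP[t0 t1]; rewrite ler0_norm// ler0_norm ?lerN2//.
    exact: ltW.
  have [||c cI] := @MVT_segment R g (fun t : R => 'D_v f (t *: v + x)) a 0 (ltW a0).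
  + by move=> t tI; apply: gd; apply: ta; exact: subset_itv_oo_cc tI.
  + by apply: derivable_within_continuous => t tI; apply: ex_derive; apply: gd; exact: ta.
  rewrite sub0r mulrC => gE; exists c; first exact: ta.
  by rewrite -opprB gE mulNr opprK.
Qed.

End MeanValue.

Section ContinuousPartials.
Variables (R : realType) (m : nat).
Implicit Types (f : 'rV[R]_m -> R) (x v h : 'rV[R]_m) (U : set 'rV[R]_m).

Lemma norm_entry_le h i : `|h 0 i| <= `|h|.
Proof.
rewrite [leRHS]/Num.Def.normr /= mx_normrE.
exact: (@le_bigmax _ _ _ _ (fun ij : 'I_1 * 'I_m => `|h ij.1 ij.2|) (0, i)).
Qed.

Lemma norm_le_entries h (r : R) : 0 <= r -> (forall i, `|h 0 i| <= r) -> `|h| <= r.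
Proof.
move=> r0 hr; rewrite [leLHS]/Num.Def.normr /= mx_normrE.
by apply: bigmax_le => // -[i j] _ /=; rewrite ord1.
Qed.

(** Go from x to x + h along the coordinate axes and apply the mean value theorem
    on each of the m segments: for the supremum norm, they all stay in the ball
    of radius |h| around x. *)
Lemma differentiable_of_partials f U : open U ->
  (forall i x, U x -> derivable f x (delta_mx 0 i)) ->
  (forall i x, U x -> {for x, continuous ('D_(delta_mx 0 i) f)}) ->
  forall x, U x -> differentiable f x.
Proof.
move=> oU fd fc x Ux.
pose L h := \sum_i h 0 i * 'D_(delta_mx 0 i) f x.
have Llin : linear L.
  move=> a u v; rewrite /L scaler_sumr -big_split /=; apply: eq_bigr => i _.
  by rewrite !mxE mulrDl -mulrA.
pose LM := GRing.isLinear.Build _ _ _ _ L Llin.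
pose Ll : {linear 'rV[R]_m -> R} := HB.pack L LM.
apply: (@differentiable_of_eps _ _ _ f Ll).
  move=> y /=; apply: differentiable_continuous.
  rewrite (_ : L = \sum_i (fun h => h 0 i * 'D_(delta_mx 0 i) f x)); last first.
    by apply/funext => h; rewrite fct_sumE.
  apply: differentiable_sum => i; apply: differentiableM => //.
  exact: differentiable_coord.
move=> e e0.
(* A ball on which all partial derivatives vary by at most e / (m + 1). *)
have m1 : 0 < (m%:R + 1 : R) by rewrite ltr_wpDl.
pose d := e / (m%:R + 1); have d0 : 0 < d by rewrite divr_gt0.
have : \forall y \near x, U y /\ forall i, `|'D_(delta_mx 0 i) f x - 'D_(delta_mx 0 i) f y| <= d.
  near=> y; split; first by near: y; exact: open_nbhs_nbhs.
  move=> i; move: i; near: y; apply: filter_forall => i.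
  have /cvgrPdist_le := fc i x Ux; exact.
move=> /nbhs_ballP[r /= r0 rE].
near=> h.
have hr : `|h| < r.
  near: h; apply/nbhs_ballP; exists r => //= z; rewrite -ball_normE /= sub0r normrN //.
(* The truncations of h join x to x + h by coordinate segments. *)
pose z k : 'rV[R]_m := \row_j (if (j < k)%N then h 0 j else 0).
have zS (k : 'I_m) : z k.+1 = h 0 k *: delta_mx 0 k + z k.
  apply/rowP => j; rewrite !mxE eqxx /= ltnS leq_eqVlt -val_eqE /=.
  case: eqP => [jk|_] /=; last by rewrite mulr0 add0r.
  by rewrite (_ : j = k) ?ltnn ?mulr1 ?addr0//; apply: val_inj.
have step (k : 'I_m) : `|f (z k.+1 + x) - f (z k + x) - h 0 k * 'D_(delta_mx 0 k) f x| <= d * `|h|.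
  have inb (t : R) : `|t| <= `|h 0 k| -> ball x r (t *: delta_mx 0 k + (z k + x)).
    move=> th; rewrite -ball_normE /= addrA -normrN opprB addrK.
    apply: le_lt_trans hr; apply: norm_le_entries => // j; rewrite !mxE eqxx /=.
    case: eqP => [->|_]; rewrite ?ltnn /= ?mulr1 ?mulr0 ?addr0 ?add0r.
      exact: le_trans (norm_entry_le h k).
    by case: ifP => _; rewrite ?normr0//; exact: norm_entry_le.
  have [t tk] := @mean_value_line R _ f (z k + x) (delta_mx 0 k) (h 0 k)
    (fun t th => fd k _ (rE _ (inb t th)).1).
  rewrite addrA -zS => ->; rewrite -mulrBr normrM mulrC distrC.
  have [_ Dk] := rE _ (inb t tk).
  by apply: ler_pM => //; exact: norm_entry_le.
have zm : z m = h by apply/rowP => j; rewrite mxE ltn_ord.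
have z0 : z 0%N = 0 by apply/rowP => j; rewrite !mxE ltn0.
have -> : f (h + x) - f x - L h =
    \sum_(k < m) (f (z k.+1 + x) - f (z k + x) - h 0 k * 'D_(delta_mx 0 k) f x).
  rewrite sumrB; congr (_ - _).
  rewrite -(big_mkord xpredT (fun k => f (z k.+1 + x) - f (z k + x))).
  by rewrite telescope_sumr// zm z0 add0r.
apply: le_trans (ler_norm_sum _ _ _) _.
apply: (@le_trans _ _ (\sum_(k < m) d * `|h|)).
  by apply: ler_sum => k _; exact: step.
rewrite sumr_const card_ord -[leLHS]mulr_natl mulrA ler_wpM2r// /d mulrCA.
by rewrite -[leRHS]mulr1 ler_wpM2l ?(ltW e0)// ler_pdivrMr// mul1r lerDl.
Unshelve. all: by end_near. Qed.

(** The second difference on a square of side s is, by two applications of the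
    mean value theorem, s ^ 2 times a value of the mixed derivative nearby. *)
Lemma second_difference f U x u v : open U -> U x ->
  (forall y, U y -> derivable f y u) ->
  (forall y, U y -> derivable ('D_u f) y v) ->
  {for x, continuous ('D_v ('D_u f))} ->
  forall e, 0 < e -> \forall s \near (0 : R),
    `|f (s *: u + (s *: v + x)) - f (s *: u + x) - f (s *: v + x) + f x
      - s ^+ 2 * 'D_v ('D_u f) x| <= e * s ^+ 2.
Proof.
move=> oU Ux fu fuv fc e e0.
have : \forall y \near x, U y /\ `|'D_v ('D_u f) x - 'D_v ('D_u f) y| <= e.
  near=> y; split; first by near: y; exact: open_nbhs_nbhs.
  by near: y; move/cvgrPdist_le : fc; exact.
move=> /nbhs_ballP[r /= r0 rE].
near=> s.
have sr : `|s| * (`|u| + `|v| + 1) < r.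
  rewrite -ltr_pdivlMr ?ltr_wpDl//; near: s.
  apply/nbhs_ballP; exists (r / (`|u| + `|v| + 1)) => /=.
    by rewrite divr_gt0// ltr_wpDl.
  by move=> z; rewrite -ball_normE /= sub0r normrN.
have inb (a b : R) : `|a| <= `|s| -> `|b| <= `|s| -> ball x r (b *: v + (a *: u + x)).
  move=> sa sb; rewrite -ball_normE /= addrA -normrN opprB addrK.
  apply: le_lt_trans sr; apply: le_trans (ler_normD _ _) _.
  rewrite !normrZ (addrC `|u|) !mulrDr mulr1.
  apply: le_trans (_ : `|s| * `|v| + `|s| * `|u| <= _).
    by apply: lerD; apply: ler_pM.
  by rewrite lerDl.
have n0 : `|0 : R| <= `|s| by rewrite normr0.
pose g y := f (s *: v + y) - f y.
have svy (t : R) : `|t| <= `|s| -> U (s *: v + (t *: u + x)).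
  by move=> ts; apply: (rE _ (inb _ _ ts (lexx _))).1.
have ty (t : R) : `|t| <= `|s| -> U (t *: u + x).
  by move=> ts; have := (rE _ (inb _ _ ts n0)).1; rewrite scale0r add0r.
have shd y : derivable f (s *: v + y) u ->
    is_derive y u (fun y => f (s *: v + y)) ('D_u f (s *: v + y)).
  move=> fd.
  have E : (fun h : R => h^-1 *: (((fun y => f (s *: v + y)) \o shift y) (h *: u) - f (s *: v + y)))
       = (fun h : R => h^-1 *: ((f \o shift (s *: v + y)) (h *: u) - f (s *: v + y))).
    by apply/funext => h /=; rewrite addrCA.
  by split; rewrite /derivable /derive /= E.
have gd (t : R) : `|t| <= `|s| ->
    is_derive (t *: u + x) u g ('D_u f (s *: v + (t *: u + x)) - 'D_u f (t *: u + x)).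
  move=> ts; apply: is_deriveB; last by apply: derivableP; apply: fu; exact: ty.
  by apply: shd; apply: fu; exact: svy.
have [|a sa gE] := @mean_value_line R _ g x u s.
  by move=> t ts; apply: ex_derive; exact: gd.
have [|b sb fE] := @mean_value_line R _ ('D_u f) (a *: u + x) v s.
  by move=> t ts; apply: fuv; exact: (rE _ (inb _ _ sa ts)).1.
have -> : f (s *: u + (s *: v + x)) - f (s *: u + x) - f (s *: v + x) + f x = g (s *: u + x) - g x.
  by rewrite /g (addrCA (s *: v)) opprB -!addrA (addrC (f x)).
rewrite gE (derive_val (is_derive := gd a sa)) fE mulrA -expr2 -mulrBr normrM distrC mulrC.
rewrite ger0_norm ?sqr_ge0// ler_wpM2r ?sqr_ge0//.
exact: (rE _ (inb _ _ sa sb)).2.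
Unshelve. all: by end_near. Qed.

(** The second difference is symmetric in u and v, and divided by s ^ 2 it tends
    to either mixed derivative. *)
Lemma derive_comm f U x u v : open U -> U x ->
  (forall y, U y -> derivable f y u) -> (forall y, U y -> derivable f y v) ->
  (forall y, U y -> derivable ('D_u f) y v) ->
  (forall y, U y -> derivable ('D_v f) y u) ->
  {for x, continuous ('D_v ('D_u f))} -> {for x, continuous ('D_u ('D_v f))} ->
  'D_v ('D_u f) x = 'D_u ('D_v f) x.
Proof.
move=> oU Ux fu fv fuv fvu cuv cvu.
apply/eqP; rewrite -subr_eq0 -normr_le0; apply/ler_addgt0Pl => e e0; rewrite addr0.
have e20 : 0 < e / 2 by rewrite divr_gt0.
have H1 := nbhs_dnbhs (second_difference oU Ux fu fuv cuv e20).
have H2 := nbhs_dnbhs (second_difference oU Ux fv fvu cvu e20).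
have nz : \forall s \near (0 : R)^', s != 0 by exact: nbhs_dnbhs_neq.
have near0 : \forall s \near (0 : R)^', `|'D_v ('D_u f) x - 'D_u ('D_v f) x| <= e.
  apply: filterS (filterI nz (filterI H1 H2)) => s [s0 [h1 h2]].
  have sE : s *: v + (s *: u + x) = s *: u + (s *: v + x) by rewrite addrCA.
  have s2 : 0 < s ^+ 2 by rewrite exprn_even_gt0.
  move: h1 h2; rewrite sE.
  move: (f (_ + (_ + _))) (f (s *: u + x)) (f (s *: v + x)) (f x) => A B C D.
  move: ('D_v _ x) ('D_u _ x) => P Q; rewrite (addrAC A (- C)) => h1 h2.
  rewrite -(ler_pM2l s2) -[X in X * _ <= _](ger0_norm (ltW s2)) -normrM mulrBr.
  apply: le_trans (ler_distD (A - B - C + D) _ _) _.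
  have -> : s ^+ 2 * e = e / 2 * s ^+ 2 + e / 2 * s ^+ 2 by rewrite -mulrDl -splitr mulrC.
  apply: lerD; last exact: h2.
  by rewrite distrC; exact: h1.
by have [s] := @filter_ex _ (0 : R)^' _ _ near0.
Qed.

End ContinuousPartials.

Section SmoothFunctions.
Variables (R : realType) (m : nat).
Implicit Types (f g : 'rV[R]_m -> R) (x v : 'rV[R]_m) (U : set 'rV[R]_m).

Lemma derive_coords (W : normedModType R) (f : 'rV[R]_m -> W) x v : differentiable f x ->
  'D_v f x = \sum_i v 0 i *: 'D_(delta_mx 0 i) f x.
Proof.
move=> df; rewrite deriveE// [in LHS](row_sum_delta v) linear_sum.
by apply: eq_bigr => i _; rewrite linearZ deriveE.
Qed.

(** Derivatives are taken in all directions, and differentiability replaces the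
    existence of partial derivatives, because the chain rule needs it; by
    [diffn_of_Ck] no generality is lost on open sets. *)
Fixpoint diffn (k : nat) U f : Prop :=
  if k is k'.+1 then
    (forall x, U x -> differentiable f x) /\ forall v, diffn k' U ('D_v f)
  else forall x, U x -> {for x, continuous f}.

Definition smoothf U f := forall k, diffn k U f.

Lemma diffnW k U f : diffn k.+1 U f -> diffn k U f.
Proof.
elim: k f => [|k IH] f [fd fD].
  by move=> x Ux; apply: differentiable_continuous; exact: fd.
by split=> // v; apply: IH; exact: fD.
Qed.

Lemma diffn_sub k U U' f : U' `<=` U -> diffn k U f -> diffn k U' f.
Proof.
move=> U'U; elim: k f => [|k IH] f /=; first by move=> fc x /U'U /fc.
by move=> [fd fD]; split=> [x /U'U /fd//|v]; exact: IH.
Qed.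

Lemma diffn_cst k U a : diffn k U (fun=> a).
Proof.
elim: k a => [|k IH] a; first by move=> x _; exact: cst_continuous.
split=> [x _|v]; first exact: differentiable_cst.
by rewrite (_ : derive _ ^~ v = fun=> 0)//; apply/funext => x; exact: derive_cst.
Qed.

Section OnOpen.
Variable U : set 'rV[R]_m.
Hypothesis oU : open U.

Lemma near_open x (P : 'rV[R]_m -> Prop) : U x -> (forall y, U y -> P y) ->
  \forall y \near x, P y.
Proof.
move=> Ux PU; have : nbhs x U by exact: open_nbhs_nbhs.
by apply: filterS => y; exact: PU.
Qed.

Lemma derive_eq_on (W : normedModType R) (f g : 'rV[R]_m -> W) x v :
  (forall y, U y -> f y = g y) -> U x -> 'D_v f x = 'D_v g x.
Proof. by move=> fg Ux; apply: near_eq_derive; exact: near_open. Qed.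

Lemma continuous_eq_on (W : normedModType R) (f g : 'rV[R]_m -> W) x :
  (forall y, U y -> f y = g y) -> U x -> {for x, continuous f} ->
  {for x, continuous g}.
Proof.
move=> fg Ux fc; have fgx : \forall y \near x, f y = g y := near_open Ux fg.
have fcx : f @ x --> g x by rewrite -fg.
exact: cvg_trans (near_eq_cvg fgx) fcx.
Qed.

Lemma diffn_eq k f g : (forall x, U x -> f x = g x) -> diffn k U f -> diffn k U g.
Proof.
elim: k f g => [|k IH] f g fg /=.
  by move=> fc x Ux; exact: continuous_eq_on fg Ux (fc x Ux).
move=> [fd fD]; split=> [x Ux|v].
  by apply: near_eq_differentiable (fd x Ux); exact: near_open.
by apply: IH (fD v) => x Ux; exact: derive_eq_on.
Qed.

Lemma diffnD k f g : diffn k U f -> diffn k U g -> diffn k U (fun x => f x + g x).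
Proof.
elim: k f g => [|k IH] f g /=.
  by move=> fc gc x Ux; apply: continuousD; [exact: fc|exact: gc].
move=> [fd fD] [gd gD]; split=> [x Ux|v].
  by apply: differentiableD; [exact: fd|exact: gd].
apply: diffn_eq (IH _ _ (fD v) (gD v)) => x Ux; apply/esym.
by apply: deriveD; apply: diff_derivable; [exact: fd|exact: gd].
Qed.

Lemma diffnM k f g : diffn k U f -> diffn k U g -> diffn k U (fun x => f x * g x).
Proof.
elim: k f g => [|k IH] f g.
  by move=> fc gc x Ux; apply: continuousM; [exact: fc|exact: gc].
move=> f' g'; have [[fd fD] [gd gD]] := (f', g'); split=> [x Ux|v].
  by apply: differentiableM; [exact: fd|exact: gd].
apply: diffn_eq (diffnD (IH _ _ (diffnW f') (gD v)) (IH _ _ (diffnW g') (fD v))).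
move=> x Ux; apply/esym.
by apply: deriveM; apply: diff_derivable; [exact: fd|exact: gd].
Qed.

Lemma diffnV k f : (forall x, U x -> f x != 0) -> diffn k U f ->
  diffn k U (fun x => (f x)^-1).
Proof.
move=> f0; elim: k => [|k IH].
  by move=> fc x Ux; apply: continuousV; [exact: f0|exact: fc].
move=> f'; have [fd fD] := f'; split=> [x Ux|v].
  by apply: differentiableV; [exact: fd|exact: f0].
have Vk := IH (diffnW f').
apply: diffn_eq (diffnM (diffn_cst k U (-1)) (diffnM (diffnM Vk Vk) (fD v))).
move=> x Ux; apply/esym; rewrite deriveV; [|exact: f0|].
  by rewrite mulN1r /GRing.scale /= expr2 invfM mulNr.
by apply: diff_derivable; exact: fd.
Qed.

Lemma diffn_sum k (I : finType) (F : I -> 'rV[R]_m -> R) :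
  (forall i, diffn k U (F i)) -> diffn k U (fun x => \sum_i F i x).
Proof.
move=> FU; have : forall s : seq I, diffn k U (fun x => \sum_(i <- s) F i x).
  elim=> [|i s IH].
    by apply: diffn_eq (diffn_cst k U 0) => x _; rewrite big_nil.
  by apply: diffn_eq (diffnD (FU i) IH) => x _; rewrite big_cons.
by move/(_ (index_enum I)).
Qed.

Lemma diffn_prod k (I : finType) (F : I -> 'rV[R]_m -> R) :
  (forall i, diffn k U (F i)) -> diffn k U (fun x => \prod_i F i x).
Proof.
move=> FU; have : forall s : seq I, diffn k U (fun x => \prod_(i <- s) F i x).
  elim=> [|i s IH].
    by apply: diffn_eq (diffn_cst k U 1) => x _; rewrite big_nil.
  by apply: diffn_eq (diffnM (FU i) IH) => x _; rewrite big_cons.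
by move/(_ (index_enum I)).
Qed.

Lemma differentiable_sqrt (t : R) : 0 < t -> differentiable (@Num.sqrt R) t.
Proof. by move=> t0; apply/derivable1_diffP; have [] := is_derive1_sqrt t0. Qed.

Lemma derive_sqrt_comp f x v : 0 < f x -> differentiable f x ->
  'D_v (fun y => Num.sqrt (f y)) x = 'D_v f x * (2 * Num.sqrt (f x))^-1.
Proof.
move=> f0 fd; have sd := differentiable_sqrt f0.
rewrite deriveE; last exact: (differentiable_comp fd sd).
rewrite (diff_comp fd sd) /= -(deriveE v fd).
have E (a : R) : a = a *: (1 : R) by rewrite /GRing.scale /= mulr1.
by rewrite (E ('D_v f x)) linearZ /= -deriveE// derive_sqrt// -E.
Qed.

Lemma diffn_sqrt k f : (forall x, U x -> 0 < f x) -> diffn k U f ->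
  diffn k U (fun x => Num.sqrt (f x)).
Proof.
move=> f0; elim: k => [|k IH].
  move=> fc x Ux; apply: continuous_comp; first exact: fc.
  exact: sqrt_continuous.
move=> f'; have [fd fD] := f'; split=> [x Ux|v].
  by apply: (differentiable_comp (fd x Ux)); apply: differentiable_sqrt; exact: f0.
have Sk := IH (diffnW f').
apply: (diffn_eq _ (diffnM (fD v) (diffnV _ (diffnM (diffn_cst k U 2) Sk)))).
  by move=> x Ux; rewrite derive_sqrt_comp//; [exact: f0|exact: fd].
by move=> x Ux; rewrite mulf_neq0// gt_eqF// sqrtr_gt0 f0.
Qed.

Lemma Ck_eq k (W : normedModType R) (f g : 'rV[R]_m -> W) :
  (forall x, U x -> f x = g x) -> Ck k U f -> Ck k U g.
Proof.
have Cc (h h' : 'rV[R]_m -> W) : (forall x, U x -> h x = h' x) ->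
    (forall x, U x -> {for x, continuous h}) -> forall x, U x -> {for x, continuous h'}.
  by move=> hh' hc x Ux; exact: continuous_eq_on hh' Ux (hc x Ux).
elim: k f g => [|k IH] f g fg /= [fc fD]; split=> //; try exact: Cc fg fc.
move=> i; have [fd fDi] := fD i; split=> [x Ux|].
  by apply: near_eq_derivable (fd x Ux); exact: near_open.
by apply: IH fDi => x Ux; exact: derive_eq_on.
Qed.

Lemma diffn_of_Ck k f : Ck k U f -> diffn k U f.
Proof.
elim: k f => [|k IH] f; first by case.
move=> [fc fD].
have fd x : U x -> differentiable f x.
  apply: (differentiable_of_partials oU) => i y Uy; first exact: (fD i).1.
  have [_] := fD i; case: k {IH fD} => [|k] [pc _]; exact: pc.
split=> // v.
apply: (@diffn_eq _ (fun x => \sum_i v 0 i * 'D_(delta_mx 0 i) f x)).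
  by move=> x Ux; rewrite (derive_coords _ (fd x Ux)).
apply: diffn_sum => i; apply: diffnM; first exact: diffn_cst.
by apply: IH; exact: (fD i).2.
Qed.

Lemma Ck_entry k p q (F : 'rV[R]_m -> 'M[R]_(p, q)) i j :
  Ck k U F -> Ck k U (fun x => F x i j : R).
Proof.
elim: k F => [|k IH] F /= [Fc FD]; split=> //.
1,2: move=> x Ux; apply: (@continuous_comp _ _ _ F (fun N : 'M[R]_(p, q) => N i j)).
1,3: exact: Fc.
1,2: exact: coord_continuous.
move=> l; have [Fd FDl] := FD l; split=> [x Ux|].
  exact: ((derivable_mxP F x (delta_mx 0 l)).1 (Fd x Ux) i j).
by apply: Ck_eq (IH _ FDl) => x Ux; rewrite derive_mx ?mxE//; exact: Fd.
Qed.

Lemma smoothf_eq f g : (forall x, U x -> f x = g x) -> smoothf U f -> smoothf U g.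
Proof. by move=> fg fs k; exact: diffn_eq fg (fs k). Qed.

Lemma smoothf_cst a : smoothf U (fun=> a).
Proof. by move=> k; exact: diffn_cst. Qed.

Lemma smoothfD f g : smoothf U f -> smoothf U g -> smoothf U (fun x => f x + g x).
Proof. by move=> fs gs k; exact: diffnD. Qed.

Lemma smoothfM f g : smoothf U f -> smoothf U g -> smoothf U (fun x => f x * g x).
Proof. by move=> fs gs k; exact: diffnM. Qed.

Lemma smoothfN f : smoothf U f -> smoothf U (fun x => - f x).
Proof.
move=> fs; apply: smoothf_eq (smoothfM (smoothf_cst (-1)) fs) => x _.
by rewrite mulN1r.
Qed.

Lemma smoothf_sum (I : finType) (F : I -> 'rV[R]_m -> R) :
  (forall i, smoothf U (F i)) -> smoothf U (fun x => \sum_i F i x).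
Proof. by move=> Fs k; apply: diffn_sum => i; exact: Fs. Qed.

Lemma smoothf_prod (I : finType) (F : I -> 'rV[R]_m -> R) :
  (forall i, smoothf U (F i)) -> smoothf U (fun x => \prod_i F i x).
Proof. by move=> Fs k; apply: diffn_prod => i; exact: Fs. Qed.

Lemma smoothfV f : (forall x, U x -> f x != 0) -> smoothf U f ->
  smoothf U (fun x => (f x)^-1).
Proof. by move=> f0 fs k; exact: diffnV. Qed.

Lemma smoothf_sqrt f : (forall x, U x -> 0 < f x) -> smoothf U f ->
  smoothf U (fun x => Num.sqrt (f x)).
Proof. by move=> f0 fs k; exact: diffn_sqrt. Qed.

Lemma smoothf_derive f v : smoothf U f -> smoothf U ('D_v f).
Proof. by move=> fs k; exact: (fs k.+1).2. Qed.

Lemma smoothf_differentiable f x : smoothf U f -> U x -> differentiable f x.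
Proof. by move=> fs Ux; exact: (fs 1%N).1. Qed.

Lemma smoothf_derive_comm f u v x : smoothf U f -> U x ->
  'D_v ('D_u f) x = 'D_u ('D_v f) x.
Proof.
move=> fs Ux; apply: (derive_comm oU Ux) => [y Uy|y Uy|y Uy|y Uy||].
1-4: apply: diff_derivable; apply: smoothf_differentiable => //; do ?exact: smoothf_derive.
all: by apply: (smoothf_derive _ (smoothf_derive _ fs) 0%N).
Qed.

End OnOpen.
End SmoothFunctions.

Lemma diffn_comp (R : realType) m n k (U : set 'rV[R]_m) (U' : set 'rV[R]_n)
    (h : 'rV[R]_n -> R) (phi : 'rV[R]_m -> 'rV[R]_n) :
  open U -> (forall x, U x -> U' (phi x)) ->
  (forall j, smoothf U (fun x => phi x 0 j)) -> diffn k U' h ->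
  diffn k U (fun x => h (phi x)).
Proof.
move=> oU UU' phis.
have phid x : U x -> differentiable phi x.
  move=> Ux; apply: differentiable_entries => i j; rewrite ord1.
  exact: smoothf_differentiable (phis j) Ux.
elim: k h => [|k IH] h.
  move=> hc x Ux; apply: continuous_comp; last exact/hc/UU'.
  by apply: differentiable_continuous; exact: phid.
move=> [hd hD]; split=> [x Ux|v].
  by apply: (differentiable_comp (phid x Ux)); exact/hd/UU'.
apply: (@diffn_eq _ _ U oU _
  (fun x => \sum_j 'D_v (fun y => phi y 0 j) x * 'D_(delta_mx 0 j) h (phi x))).
  move=> x Ux; have hx := hd _ (UU' x Ux).
  rewrite [in RHS]deriveE; last exact: (differentiable_comp (phid x Ux) hx).
  rewrite (diff_comp (phid x Ux) hx) /= -(deriveE v (phid x Ux)).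
  rewrite -deriveE// derive_coords//; apply: eq_bigr => j _.
  by rewrite derive_mx ?mxE//; apply: diff_derivable; exact: phid.
apply: diffn_sum => // j; apply: diffnM => //.
  exact: (phis j k.+1).2.
exact: (IH _ (hD (delta_mx 0 j))).
Qed.

Lemma derive_const_on (R : realType) m (U : set 'rV[R]_m) (W : normedModType R)
    (f : 'rV[R]_m -> W) (c : W) x u :
  open U -> (forall y, U y -> f y = c) -> U x -> 'D_u f x = 0.
Proof.
move=> oU fc Ux; rewrite (derive_eq_on oU u (g := fun=> c) fc Ux).
exact: derive_cst.
Qed.

Lemma derive_at_max (R : realType) m (U0 : set 'rV[R]_m) (f : 'rV[R]_m -> R) x v :
  open U0 -> U0 x ->
  (forall y, U0 y -> differentiable f y) -> (forall y, U0 y -> f y <= f x) ->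
  'D_v f x = 0.
Proof.
move=> oU0 U0x fd fmax.
have : \forall t \near (0 : R), U0 (t *: v + x).
  have c : {for (0 : R), continuous (fun t : R => t *: v + x)}.
    by apply: continuousD; [exact: scalel_continuous|exact: cst_continuous].
  by apply: c; rewrite scale0r add0r; exact: open_nbhs_nbhs.
move=> /nbhs_ballP[r /= r0 rE].
have inU (t : R) : t \in `]-r, r[ -> U0 (t *: v + x).
  move=> tr; apply: rE; rewrite -ball_normE /= sub0r normrN ltr_norml.
  by move: tr; rewrite in_itv.
have gd (t : R) : t \in `]-r, r[ ->
    is_derive t (1 : R) (fun s : R => f (s *: v + x)) ('D_v f (t *: v + x)).
  by move=> tr; apply: is_derive_line; apply: diff_derivable; apply: fd; exact: inU.
have i0 : (0 : R) \in `]-r, r[ by rewrite in_itv /= r0 oppr_lt0 r0.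
have [|||_] := @derive1_at_max R (fun s : R => f (s *: v + x)) (-r) r 0 _ _ i0.
- by rewrite ge0_cp// ltW.
- by move=> t tr; have [] := gd t tr.
- by move=> t tr; rewrite scale0r add0r; apply: fmax; exact: inU.
by have [_ ->] := gd 0 i0; rewrite scale0r add0r.
Qed.

(** * Derivatives of matrix-valued functions *)

Section MatrixDerivatives.
Variables (R : realType) (V : normedModType R).
Implicit Types (x v : V).

Lemma derive_entry p q (F : V -> 'M[R]_(p, q)) x v i j : differentiable F x ->
  'D_v F x i j = 'D_v (fun y => F y i j) x.
Proof. by move=> Fd; rewrite derive_mx ?mxE//; exact: diff_derivable. Qed.

Lemma derive_scaled_dir (W : normedModType R) (F : V -> W) x a v : differentiable F x ->
  'D_(a *: v) F x = a *: 'D_v F x.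
Proof. by move=> Fd; rewrite !deriveE// linearZ. Qed.

Lemma derive_compE (W W' : normedModType R) (F : V -> W) (H : W -> W') x v :
  differentiable F x -> differentiable H (F x) ->
  'D_v (fun y => H (F y)) x = 'D_('D_v F x) H (F x).
Proof.
move=> Fd Hd; rewrite (deriveE ('D_v F x) Hd) (deriveE v Fd).
by rewrite (deriveE v (differentiable_comp Fd Hd)) diff_comp.
Qed.

Lemma differentiable_mulmx p q r (F : V -> 'M[R]_(p, q)) (H : V -> 'M[R]_(q, r)) x :
  differentiable F x -> differentiable H x ->
  differentiable (fun y => F y *m H y) x.
Proof.
move=> Fd Hd; apply: differentiable_entries => i j.
rewrite (_ : (fun y => _) = \sum_k (fun y => F y i k * H y k j)); last first.
  by apply/funext => y; rewrite mxE fct_sumE.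
by apply: differentiable_sum => k; apply: differentiableM; exact: differentiable_entry.
Qed.

Lemma derive_mulmx p q r (F : V -> 'M[R]_(p, q)) (H : V -> 'M[R]_(q, r)) x v :
  differentiable F x -> differentiable H x ->
  'D_v (fun y => F y *m H y) x = 'D_v F x *m H x + F x *m 'D_v H x.
Proof.
move=> Fd Hd; apply/matrixP => i j.
rewrite derive_entry; last exact: differentiable_mulmx.
rewrite (_ : (fun y => _) = \sum_k (fun y => F y i k * H y k j)); last first.
  by apply/funext => y; rewrite mxE fct_sumE.
have Fik k : derivable (fun y => F y i k : R) x v.
  by apply: diff_derivable; exact: differentiable_entry.
have Hkj k : derivable (fun y => H y k j : R) x v.
  by apply: diff_derivable; exact: differentiable_entry.
rewrite derive_sum; last by move=> k; apply: derivableM.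
rewrite !mxE -big_split; apply: eq_bigr => k _ /=.
rewrite (deriveM (Fik k) (Hkj k)) (derive_entry v i k Fd) (derive_entry v k j Hd).
by rewrite addrC; congr (_ + _); rewrite [LHS]mulrC.
Qed.

Lemma derive_trmx p q (F : V -> 'M[R]_(p, q)) x v : differentiable F x ->
  'D_v (fun y => (F y)^T) x = ('D_v F x)^T.
Proof.
move=> Fd; have FTd : differentiable (fun y => (F y)^T) x.
  apply: differentiable_entries => i j.
  rewrite (_ : (fun y => _) = fun y => F y j i); first exact: differentiable_entry.
  by apply/funext => y; rewrite mxE.
apply/matrixP => i j; rewrite mxE !derive_entry//; congr ('D_v _ x).
by apply/funext => y; rewrite mxE.
Qed.

Lemma differentiable_trmx p q (F : V -> 'M[R]_(p, q)) x : differentiable F x ->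
  differentiable (fun y => (F y)^T) x.
Proof.
move=> Fd; apply: differentiable_entries => i j.
rewrite (_ : (fun y => _) = fun y => F y j i); first exact: differentiable_entry.
by apply/funext => y; rewrite mxE.
Qed.

End MatrixDerivatives.

Section Bilin.
Variables (R : realType) (m : nat).
Implicit Types (A : 'M[R]_m) (u v w : 'rV[R]_m) (a : R).

Lemma bilinE A u v : bilin A u v = \sum_i \sum_j u 0 i * A i j * v 0 j.
Proof.
rewrite /bilin mxE exchange_big; apply: eq_bigr => j _ /=.
by rewrite !mxE mulr_suml.
Qed.

Lemma bilinDl A u v w : bilin A (u + v) w = bilin A u w + bilin A v w.
Proof. by rewrite /bilin !mulmxDl mxE. Qed.

Lemma bilinDr A u v w : bilin A w (u + v) = bilin A w u + bilin A w v.
Proof. by rewrite /bilin linearD mulmxDr mxE. Qed.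

Lemma bilinZl A a u w : bilin A (a *: u) w = a * bilin A u w.
Proof. by rewrite /bilin -!scalemxAl mxE. Qed.

Lemma bilinZr A a u w : bilin A w (a *: u) = a * bilin A w u.
Proof. by rewrite /bilin linearZ -scalemxAr mxE. Qed.

Lemma bilinNl A u w : bilin A (- u) w = - bilin A u w.
Proof. by rewrite -scaleN1r bilinZl mulN1r. Qed.

Lemma bilinNr A u w : bilin A w (- u) = - bilin A w u.
Proof. by rewrite -scaleN1r bilinZr mulN1r. Qed.

Lemma bilinBl A u v w : bilin A (u - v) w = bilin A u w - bilin A v w.
Proof. by rewrite bilinDl bilinNl. Qed.

Lemma bilinBr A u v w : bilin A w (u - v) = bilin A w u - bilin A w v.
Proof. by rewrite bilinDr bilinNr. Qed.

Lemma bilin0l A w : bilin A 0 w = 0.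
Proof. by rewrite /bilin !mul0mx mxE. Qed.

Lemma bilin0r A w : bilin A w 0 = 0.
Proof. by rewrite /bilin trmx0 mulmx0 mxE. Qed.

Lemma bilinC A u v : A^T = A -> bilin A u v = bilin A v u.
Proof.
move=> As; rewrite /bilin; transitivity ((u *m A *m v^T)^T 0 0); first by rewrite [RHS]mxE.
by rewrite !trmx_mul trmxK As mulmxA.
Qed.

Lemma bilin_delta A i j : bilin A (delta_mx 0 i) (delta_mx 0 j) = A i j.
Proof. by rewrite /bilin trmx_delta -rowE -colE !mxE. Qed.

Lemma bilin_congr p (A : 'M[R]_p) (J : 'M[R]_(m, p)) u v :
  bilin (J *m A *m J^T) u v = bilin A (u *m J) (v *m J).
Proof. by rewrite /bilin trmx_mul !mulmxA. Qed.

Lemma bilin_nondeg A u v : A \in unitmx -> (forall w, bilin A u w = bilin A v w) -> u = v.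
Proof.
move=> Au uv; apply: (can_inj (mulmxK Au)); apply/rowP => i.
have := uv (delta_mx 0 i).
by rewrite /bilin trmx_delta -!colE [X in X = _]mxE [X in _ = X]mxE.
Qed.

End Bilin.

Section DeriveBilin.
Variables (R : realType) (V : normedModType R) (m : nat).

Lemma differentiable_bilin_mx (G : V -> 'M[R]_m) (E F : V -> 'rV[R]_m) x :
  differentiable G x -> differentiable E x -> differentiable F x ->
  differentiable (fun y => bilin (G y) (E y) (F y)) x.
Proof.
move=> Gd Ed Fd; apply: (differentiable_entry (F := fun y => E y *m G y *m (F y)^T)).
by do !apply: differentiable_mulmx => //; exact: differentiable_trmx.
Qed.

Lemma derive_bilin (G : V -> 'M[R]_m) (E F : V -> 'rV[R]_m) x v :
  differentiable G x -> differentiable E x -> differentiable F x ->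
  'D_v (fun y => bilin (G y) (E y) (F y)) x =
  bilin ('D_v G x) (E x) (F x) + bilin (G x) ('D_v E x) (F x)
    + bilin (G x) (E x) ('D_v F x).
Proof.
move=> Gd Ed Fd; have FTd := differentiable_trmx Fd.
have EGd := differentiable_mulmx Ed Gd.
rewrite /bilin -(derive_entry _ 0 0 (differentiable_mulmx EGd FTd)).
have addE (A B : 'M[R]_1) : (A + B) 0 0 = A 0 0 + B 0 0 by rewrite mxE.
rewrite derive_mulmx// derive_mulmx// derive_trmx// mulmxDl !addE.
by congr (_ + _); rewrite addrC.
Qed.

End DeriveBilin.

Section SmoothMatrices.
Variables (R : realType) (m : nat).
Variable U : set 'rV[R]_m.
Hypothesis oU : open U.

Definition smooth_mx p q (F : 'rV[R]_m -> 'M[R]_(p, q)) :=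
  forall i j, smoothf U (fun x => F x i j).

Lemma smooth_mx_of_smooth_on p q (F : 'rV[R]_m -> 'M[R]_(p, q)) :
  smooth_on U F -> smooth_mx F.
Proof. by move=> Fs i j k; apply: diffn_of_Ck => //; exact: Ck_entry. Qed.

Lemma smooth_mx_eq p q (F H : 'rV[R]_m -> 'M[R]_(p, q)) :
  (forall x, U x -> F x = H x) -> smooth_mx F -> smooth_mx H.
Proof. by move=> FH Fs i j; apply: smoothf_eq (Fs i j) => // x Ux; rewrite FH. Qed.

Lemma smooth_mx_cst p q (A : 'M[R]_(p, q)) : smooth_mx (fun=> A).
Proof. by move=> i j; exact: smoothf_cst. Qed.

Lemma smooth_mxD p q (F H : 'rV[R]_m -> 'M[R]_(p, q)) :
  smooth_mx F -> smooth_mx H -> smooth_mx (fun x => F x + H x).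
Proof.
move=> Fs Hs i j; apply: (smoothf_eq oU _ (smoothfD oU (Fs i j) (Hs i j))) => x _.
by rewrite mxE.
Qed.

Lemma smooth_mxN p q (F : 'rV[R]_m -> 'M[R]_(p, q)) :
  smooth_mx F -> smooth_mx (fun x => - F x).
Proof.
move=> Fs i j; apply: (smoothf_eq oU _ (smoothfN oU (Fs i j))) => x _.
by rewrite mxE.
Qed.

Lemma smooth_mxZ p q (a : 'rV[R]_m -> R) (F : 'rV[R]_m -> 'M[R]_(p, q)) :
  smoothf U a -> smooth_mx F -> smooth_mx (fun x => a x *: F x).
Proof.
move=> sa Fs i j; apply: (smoothf_eq oU _ (smoothfM oU sa (Fs i j))) => x _.
by rewrite mxE.
Qed.

Lemma smooth_mx_tr p q (F : 'rV[R]_m -> 'M[R]_(p, q)) :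
  smooth_mx F -> smooth_mx (fun x => (F x)^T).
Proof. by move=> Fs i j; apply: (smoothf_eq oU _ (Fs j i)) => x _; rewrite mxE. Qed.

Lemma smooth_mxM p q r (F : 'rV[R]_m -> 'M[R]_(p, q)) (H : 'rV[R]_m -> 'M[R]_(q, r)) :
  smooth_mx F -> smooth_mx H -> smooth_mx (fun x => F x *m H x).
Proof.
move=> Fs Hs i j.
apply: (smoothf_eq oU _ (smoothf_sum oU (fun k => smoothfM oU (Fs i k) (Hs k j)))).
by move=> x _; rewrite mxE.
Qed.

Lemma smoothf_det n (F : 'rV[R]_m -> 'M[R]_n) :
  smooth_mx F -> smoothf U (fun x => \det (F x)).
Proof.
move=> Fs; rewrite /determinant; apply: smoothf_sum => // s.
apply: smoothfM => //; first exact: smoothf_cst.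
by apply: smoothf_prod => // i; exact: Fs.
Qed.

(** Cramer's rule: the entries of the inverse are polynomials in the entries
    divided by the determinant. *)
Lemma smooth_mxV n (F : 'rV[R]_m -> 'M[R]_n) : (forall x, U x -> F x \in unitmx) ->
  smooth_mx F -> smooth_mx (fun x => invmx (F x)).
Proof.
move=> Fu Fs; apply: (@smooth_mx_eq _ _ (fun x => (\det (F x))^-1 *: \adj (F x))).
  by move=> x Ux; rewrite /invmx (Fu x Ux).
apply: smooth_mxZ.
  apply: smoothfV => //; last exact: smoothf_det.
  by move=> x Ux; have := Fu x Ux; rewrite unitmxE unitfE.
move=> i j; apply: (smoothf_eq oU (f := fun x => (-1) ^+ (j + i) * \det (row' j (col' i (F x))))).
  by move=> x Ux; rewrite mxE.
apply: smoothfM => //; first exact: smoothf_cst.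
apply: smoothf_det => k l; apply: (smoothf_eq oU _ (Fs (lift j k) (lift i l))).
by move=> x _; rewrite !mxE.
Qed.

Lemma smooth_mx_differentiable p q (F : 'rV[R]_m -> 'M[R]_(p, q)) x :
  smooth_mx F -> U x -> differentiable F x.
Proof.
move=> Fs Ux; apply: differentiable_entries => i j.
exact: smoothf_differentiable (Fs i j) Ux.
Qed.

Lemma smooth_mx_derive p q (F : 'rV[R]_m -> 'M[R]_(p, q)) v :
  smooth_mx F -> smooth_mx ('D_v F).
Proof.
move=> Fs i j; apply: (smoothf_eq oU _ (smoothf_derive v (Fs i j))) => x Ux.
by rewrite derive_entry//; exact: smooth_mx_differentiable.
Qed.

Lemma smooth_mx_derive_comm p q (F : 'rV[R]_m -> 'M[R]_(p, q)) u v x :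
  smooth_mx F -> U x -> 'D_v ('D_u F) x = 'D_u ('D_v F) x.
Proof.
move=> Fs Ux; apply/matrixP => i j.
have E w w' : ('D_w ('D_w' F) x) i j = 'D_w ('D_w' (fun y => F y i j)) x.
  rewrite derive_entry; last exact: smooth_mx_differentiable (smooth_mx_derive _ Fs) Ux.
  apply: (derive_eq_on oU _ _ Ux) => y Uy; rewrite derive_entry//.
  exact: smooth_mx_differentiable.
apply: etrans (E v u) _.
apply: etrans (@smoothf_derive_comm _ _ U oU (fun y => F y i j) u v x (Fs i j) Ux) _.
apply: esym.
exact: (E u v).
Qed.

Lemma smoothf_bilin (G : 'rV[R]_m -> 'M[R]_m) (E F : 'rV[R]_m -> 'rV[R]_m) :
  smooth_mx G -> smooth_mx E -> smooth_mx F ->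
  smoothf U (fun y => bilin (G y) (E y) (F y)).
Proof.
by move=> Gs Es Fs; apply: (smooth_mxM (smooth_mxM Es Gs) (smooth_mx_tr Fs)).
Qed.

End SmoothMatrices.

Lemma smooth_mx_sub (R : realType) m (U U' : set 'rV[R]_m) p q
  (F : 'rV[R]_m -> 'M[R]_(p, q)) : U' `<=` U -> smooth_mx U F -> smooth_mx U' F.
Proof. by move=> U'U Fs i j k; apply: diffn_sub U'U _; exact: Fs. Qed.

Lemma smooth_mx_comp (R : realType) m n (U : set 'rV[R]_m) (U' : set 'rV[R]_n) p q
    (H : 'rV[R]_n -> 'M[R]_(p, q)) (phi : 'rV[R]_m -> 'rV[R]_n) :
  open U -> (forall x, U x -> U' (phi x)) -> smooth_mx U phi -> smooth_mx U' H ->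
  smooth_mx U (fun x => H (phi x)).
Proof.
move=> oU UU' phis Hs i j k; apply: (diffn_comp oU UU' _ (Hs i j k)).
exact: phis.
Qed.

Section Jacobian.
Variables (R : realType) (m n : nat) (U : set 'rV[R]_m) (phi : 'rV[R]_m -> 'rV[R]_n).
Hypothesis oU : open U.
Hypothesis phis : smooth_mx U phi.

Lemma derive_jacobian x u : U x -> 'D_u phi x = u *m 'J phi x.
Proof. by move=> Ux; rewrite deriveEjacobian//; exact: smooth_mx_differentiable Ux. Qed.

Lemma smooth_jacobian : smooth_mx U (jacobian phi).
Proof.
move=> i j; apply: (smoothf_eq oU _ (smooth_mx_derive oU (delta_mx 0 i) phis 0 j)) => x Ux.
by rewrite derive_jacobian// -rowE mxE.
Qed.

Lemma mulmx_derive_jacobian x u v : U x -> v *m 'D_u (jacobian phi) x = 'D_u ('D_v phi) x.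
Proof.
move=> Ux; have Jd := smooth_mx_differentiable smooth_jacobian Ux.
have vd : differentiable (fun _ : 'rV[R]_m => v) x by exact: differentiable_cst.
have -> : 'D_u ('D_v phi) x = 'D_u (fun y => v *m 'J phi y) x.
  by apply: (derive_eq_on oU _ _ Ux) => y; exact: derive_jacobian.
by rewrite (derive_mulmx u vd Jd) derive_cst mul0mx add0r.
Qed.

End Jacobian.

(** * The Levi-Civita connection in a chart *)

Section LeviCivita.
Variables (R : realType) (m : nat).
Variables (U : set 'rV[R]_m) (G : 'rV[R]_m -> 'M[R]_m).
Hypothesis oU : open U.
Hypothesis Gs : smooth_mx U G.
Hypothesis Gsym : forall x, U x -> (G x)^T = G x.
Hypothesis Gu : forall x, U x -> G x \in unitmx.
Implicit Types (x u v w : 'rV[R]_m) (E F H : 'rV[R]_m -> 'rV[R]_m).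

(** Matrix of the endomorphism u |-> Gamma(u, v): since the symbols are symmetric,
    it is also the connection form in the direction v. Covariant derivatives
    become matrix products, to which the product rule applies. *)
Definition conn_mx v x : 'M[R]_m :=
  \matrix_(i, k) \sum_j christoffel G x k i j * v 0 j.

Definition gamma x u v : 'rV[R]_m :=
  \row_k \sum_i \sum_j christoffel G x k i j * u 0 i * v 0 j.

Lemma gamma_conn x u v : gamma x u v = u *m conn_mx v x.
Proof.
apply/rowP => k; rewrite !mxE; apply: eq_bigr => i _; rewrite mxE mulr_sumr.
by apply: eq_bigr => j _; rewrite mulrA (mulrC (u 0 i)).
Qed.

Lemma partial_g_sym x l i j : U x -> partial_g G x l i j = partial_g G x l j i.
Proof.
move=> Ux; have Gd := smooth_mx_differentiable Gs Ux.
rewrite /partial_g !derive_entry//; apply: (derive_eq_on oU _ _ Ux) => y Uy.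
by rewrite -[in LHS](Gsym Uy) mxE.
Qed.

Lemma christoffel_sym x k i j : U x -> christoffel G x k i j = christoffel G x k j i.
Proof.
move=> Ux; rewrite /christoffel; congr (_ * _); apply: eq_bigr => l _.
by rewrite (partial_g_sym l i j Ux) (addrC (partial_g G x i j l)).
Qed.

Lemma gamma_sym x u v : U x -> gamma x u v = gamma x v u.
Proof.
move=> Ux; apply/rowP => k; rewrite !mxE exchange_big; apply: eq_bigr => j _ /=.
by apply: eq_bigr => i _; rewrite christoffel_sym// mulrAC.
Qed.

Lemma bilin_derive_coords x u v w : U x ->
  bilin ('D_u G x) v w = \sum_i \sum_j \sum_l partial_g G x i j l * u 0 i * v 0 j * w 0 l.
Proof.
move=> Ux; have Gd := smooth_mx_differentiable Gs Ux.
rewrite bilinE exchange_big /=; rewrite [RHS]exchange_big /=.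
rewrite exchange_big /=; apply: eq_bigr => j _.
rewrite [RHS]exchange_big /=; apply: eq_bigr => l _.
rewrite (derive_coords u Gd) summxE mulr_sumr mulr_suml; apply: eq_bigr => i _.
by rewrite mxE -/(partial_g G x i j l); ring.
Qed.

(** Koszul's formula for fields with constant components. *)
Lemma gamma_metric x u v w : U x -> 2 * bilin (G x) (gamma x u v) w =
  bilin ('D_u G x) v w + bilin ('D_v G x) u w - bilin ('D_w G x) u v.
Proof.
move=> Ux.
pose L : 'rV[R]_m := \row_l \sum_i \sum_j 2^-1 *
    (partial_g G x i j l + partial_g G x j i l - partial_g G x l i j) * u 0 i * v 0 j.
have -> : gamma x u v = L *m invmx (G x).
  apply/rowP => k; rewrite !mxE.
  have invs : invmx (G x) = (invmx (G x))^T by rewrite trmx_inv Gsym.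
  under [RHS]eq_bigr => l _.
    rewrite invs !mxE mulr_suml.
    under eq_bigr do rewrite mulr_suml.
    over.
  rewrite /= [RHS]exchange_big /=; apply: eq_bigr => i _.
  rewrite [RHS]exchange_big /=; apply: eq_bigr => j _.
  rewrite /christoffel mulr_sumr !mulr_suml; apply: eq_bigr => l _; ring.
rewrite {1}/bilin (mulmxKV (Gu Ux)) [X in 2 * X]mxE.
have Eu := bilin_derive_coords u v w Ux.
have Ev := bilin_derive_coords v u w Ux.
have Ew := bilin_derive_coords w u v Ux.
rewrite [X in _ = X + _ - _]Eu.
rewrite [X in _ = _ + X - _]Ev [X in _ = _ + _ - X]Ew.
rewrite [X in _ + X - _]exchange_big /=.
have -> : \sum_l \sum_i \sum_j partial_g G x l i j * w 0 l * u 0 i * v 0 j =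
    \sum_i \sum_j \sum_l partial_g G x l i j * w 0 l * u 0 i * v 0 j.
  by rewrite exchange_big /=; apply: eq_bigr => i _; rewrite exchange_big.
rewrite -big_split -sumrB /=.
rewrite mulr_sumr.
under [LHS]eq_bigr do rewrite !mxE mulr_suml mulr_sumr.
rewrite exchange_big /=; apply: eq_bigr => i _.
rewrite -big_split -sumrB /=.
under [LHS]eq_bigr do rewrite mulr_suml mulr_sumr.
rewrite exchange_big /=; apply: eq_bigr => j _.
rewrite -big_split -sumrB /=; apply: eq_bigr => l _.
by field.
Qed.

(** In the sum of two instances of Koszul's formula, the derivatives of the metric
    other than the one along u cancel. *)
Lemma gamma_compat x u v w : U x ->
  bilin ('D_u G x) v w = bilin (G x) (gamma x u v) w + bilin (G x) v (gamma x u w).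
Proof.
move=> Ux; have Gd := smooth_mx_differentiable Gs Ux.
have DGs z : ('D_z G x)^T = 'D_z G x.
  rewrite -derive_trmx//; apply: (derive_eq_on oU _ _ Ux) => y; exact: Gsym.
have two0 : (2 : R) != 0 by rewrite pnatr_eq0.
apply: (mulfI two0); rewrite mulrDr (bilinC v _ (Gsym Ux)).
rewrite (gamma_metric u v w Ux) (gamma_metric u w v Ux).
have alg (A B C : 'M[R]_m) : A^T = A -> 2 * bilin A v w =
    bilin A v w + bilin B u w - bilin C u v + (bilin A w v + bilin C u v - bilin B u w).
  by move=> As; rewrite (bilinC w v As); ring.
exact: (alg _ _ _ (DGs u)).
Qed.

Lemma smoothf_christoffel k i j : smoothf U (fun x => christoffel G x k i j).
Proof.
rewrite /christoffel; apply: smoothfM => //; first exact: smoothf_cst.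
apply: smoothf_sum => // l; apply: smoothfM => //.
  exact: (smooth_mxV oU Gu Gs).
have Ps a b c : smoothf U (fun x => partial_g G x a b c).
  exact: (smooth_mx_derive oU _ Gs).
by apply: smoothfD => //; [apply: smoothfD|apply: smoothfN].
Qed.

Lemma smooth_conn_mx F : smooth_mx U F -> smooth_mx U (fun x => conn_mx (F x) x).
Proof.
move=> Fs i k; apply: (smoothf_eq oU (f := fun x => \sum_j christoffel G x k i j * F x 0 j)).
  by move=> x _; rewrite mxE.
by apply: smoothf_sum => // j; apply: smoothfM => //; exact: smoothf_christoffel.
Qed.

(** The covariant differential of the field F: [u *m codiff F x] is the covariant
    derivative of F along u (see [codiffE]). As a matrix-valued function it can
    be differentiated with u held fixed, which hides the dependence of the
    direction on the point. *)
Definition codiff F x : 'M[R]_m :=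
  (\matrix_(i, k) 'D_(delta_mx 0 i) F x 0 k) + conn_mx (F x) x.

Lemma codiffE F x u : smooth_mx U F -> U x ->
  u *m codiff F x = 'D_u F x + gamma x u (F x).
Proof.
move=> Fs Ux; rewrite mulmxDr gamma_conn; congr (_ + _).
rewrite (derive_coords u (smooth_mx_differentiable Fs Ux)).
apply/rowP => k; rewrite !mxE summxE; apply: eq_bigr => i _.
by rewrite !mxE.
Qed.

Lemma smooth_codiff F : smooth_mx U F -> smooth_mx U (codiff F).
Proof.
move=> Fs; apply: smooth_mxD => //; last exact: smooth_conn_mx.
move=> i k; have := smooth_mx_derive oU (delta_mx 0 i) Fs 0 k.
by apply: (smoothf_eq oU) => x _; rewrite mxE.
Qed.

Lemma codiff_compat E F x u : smooth_mx U E -> smooth_mx U F -> U x ->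
  'D_u (fun y => bilin (G y) (E y) (F y)) x =
  bilin (G x) (u *m codiff E x) (F x) + bilin (G x) (E x) (u *m codiff F x).
Proof.
move=> Es Fs Ux; have Gd := smooth_mx_differentiable Gs Ux.
have Ed := smooth_mx_differentiable Es Ux.
have Fd := smooth_mx_differentiable Fs Ux.
rewrite derive_bilin// gamma_compat// !codiffE// bilinDl bilinDr.
by ring.
Qed.

Lemma codiff_torsion E F x : smooth_mx U E -> smooth_mx U F -> U x ->
  E x *m codiff F x - F x *m codiff E x = lie_bracket E F x.
Proof.
move=> Es Fs Ux; rewrite !codiffE// (gamma_sym (F x))// /lie_bracket.
by rewrite opprD addrACA subrr addr0.
Qed.

(** Curvature as d omega + omega /\ omega for the connection form. *)
Lemma curvature_conn x u v w : U x -> curvature_at G x u v w =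
  w *m ('D_u (conn_mx v) x + conn_mx v x *m conn_mx u x
      - ('D_v (conn_mx u) x + conn_mx u x *m conn_mx v x)).
Proof.
move=> Ux.
have cs z : smooth_mx U (conn_mx z) by apply: smooth_conn_mx; exact: smooth_mx_cst.
have n1 a b y : U y -> nabla G (cst a) (cst b) y = b *m conn_mx a y.
  by move=> Uy; rewrite /nabla derive_cst add0r -/(gamma y a b) (gamma_sym a b Uy) gamma_conn.
have n2 a b : nabla G (cst a) (nabla G (cst b) (cst w)) x =
    w *m ('D_a (conn_mx b) x + conn_mx b x *m conn_mx a x).
  rewrite {1}/nabla.
  have -> : 'D_a (nabla G (cst b) (cst w)) x = w *m 'D_a (conn_mx b) x.
    rewrite (derive_eq_on oU a (fun y Uy => n1 b w y Uy) Ux).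
    rewrite derive_mulmx.
    - by rewrite derive_cst mul0mx add0r.
    - exact: differentiable_cst.
    - exact: smooth_mx_differentiable (cs b) Ux.
  rewrite -/(gamma x a (nabla G (cst b) (cst w) x)) n1// gamma_sym// gamma_conn.
  by rewrite mulmxDr mulmxA.
rewrite /curvature_at /curvature !n2 -mulmxBr.
rewrite [X in _ - X](_ : _ = 0) ?subr0//.
have -> : lie_bracket (cst u) (cst v) = cst 0.
  by apply/funext => y; rewrite /lie_bracket !derive_cst subrr.
rewrite /nabla derive_cst add0r.
apply/rowP => k; rewrite !mxE big1// => i _; rewrite big1// => j _.
by rewrite mxE mulr0 mul0r.
Qed.

(** The Ricci identity. It replaces the constant extension of the third argument
    of the curvature by an arbitrary field F; the second derivatives of F cancel
    by symmetry. *)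
Lemma codiff_curvature F x u v : smooth_mx U F -> U x ->
  (v *m 'D_u (codiff F) x + gamma x u (v *m codiff F x))
  - (u *m 'D_v (codiff F) x + gamma x v (u *m codiff F x)) =
  curvature_at G x u v (F x).
Proof.
move=> Fs Ux; rewrite curvature_conn//.
have cs z : smooth_mx U (conn_mx z) by apply: smooth_conn_mx; exact: smooth_mx_cst.
have Fd := smooth_mx_differentiable Fs Ux.
have DFd a := smooth_mx_differentiable (smooth_mx_derive oU a Fs) Ux.
have csd z := smooth_mx_differentiable (cs z) Ux.
have Nd := smooth_mx_differentiable (smooth_codiff Fs) Ux.
have half a b : b *m 'D_a (codiff F) x + gamma x a (b *m codiff F x) =
   'D_a ('D_b F) x + ('D_a F x *m conn_mx b x + 'D_b F x *m conn_mx a x)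
   + F x *m ('D_a (conn_mx b) x + conn_mx b x *m conn_mx a x).
  have -> : b *m 'D_a (codiff F) x = 'D_a (fun y => b *m codiff F y) x.
    have bd : differentiable (fun=> b) x by exact: differentiable_cst.
    by rewrite (derive_mulmx _ bd Nd) derive_cst mul0mx add0r.
  have -> : 'D_a (fun y => b *m codiff F y) x = 'D_a (fun y => 'D_b F y + F y *m conn_mx b y) x.
    apply: (derive_eq_on oU _ _ Ux) => y Uy.
    by rewrite codiffE// gamma_sym// gamma_conn.
  rewrite deriveD; [|exact: diff_derivable|apply: diff_derivable; exact: differentiable_mulmx].
  rewrite derive_mulmx// codiffE// gamma_sym// gamma_conn (gamma_sym b)// gamma_conn.
  rewrite mulmxDl mulmxDr -mulmxA !addrA; congr (_ + _).
  by rewrite -!addrA; congr (_ + (_ + _)); rewrite addrC.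
have alg (D D' A B f : 'rV[R]_m) (C C' : 'M[R]_m) : D = D' ->
    (D + (A + B) + f *m C) - (D' + (B + A) + f *m C') = f *m (C - C').
  move=> ->; rewrite mulmxBr (addrC B); move: (_ + (_ + _)) => Z.
  by rewrite opprD addrACA subrr add0r.
apply: etrans (congr2 (fun A B => A - B) (half u v) (half v u)) _.
apply: alg; exact: (smooth_mx_derive_comm oU v u Fs Ux).
Qed.

End LeviCivita.

(** * Curvature of the planes spanned by a basic and a vertical field *)

Section MixedCurvature.
Variables (R : realType) (m : nat).
Variables (U : set 'rV[R]_m) (G : 'rV[R]_m -> 'M[R]_m).
Hypothesis oU : open U.
Hypothesis Gs : smooth_mx U G.
Hypothesis Gsym : forall x, U x -> (G x)^T = G x.
Hypothesis Gu : forall x, U x -> G x \in unitmx.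
Variables (V X : 'rV[R]_m -> 'rV[R]_m) (mu : 'rV[R]_m -> R).
Hypothesis Vs : smooth_mx U V.
Hypothesis Xs : smooth_mx U X.
Hypothesis Vunit : forall y, U y -> bilin (G y) (V y) (V y) = -1.
Hypothesis XV0 : forall y, U y -> bilin (G y) (X y) (V y) = 0.
Hypothesis Xbasic : forall y, U y -> 'D_(V y) (fun z => bilin (G z) (X z) (X z)) y = 0.
Hypothesis brXV : forall y, U y -> lie_bracket X V y = mu y *: V y.

Definition field_accel y := V y *m codiff G V y.

Lemma smooth_field_accel : smooth_mx U field_accel.
Proof. by apply: smooth_mxM => //; exact: smooth_codiff. Qed.

Lemma codiff_unit_orthogonal y u : U y -> bilin (G y) (u *m codiff G V y) (V y) = 0.
Proof.
move=> Uy; have := codiff_compat oU Gs Gsym Gu u Vs Vs Uy.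
rewrite (derive_const_on u oU Vunit Uy).
rewrite [X in _ + X](bilinC _ _ (Gsym Uy)) => /eqP.
by rewrite eq_sym -mulr2n mulrn_eq0 /= => /eqP.
Qed.

Let Z y := X y *m codiff G V y.

Let ZE y : U y -> Z y = V y *m codiff G X y + mu y *: V y.
Proof.
move=> Uy; rewrite -brXV// -(codiff_torsion oU Gs Gsym Xs Vs Uy).
by rewrite addrC subrK.
Qed.

Let ZX0 y : U y -> bilin (G y) (Z y) (X y) = 0.
Proof.
move=> Uy; rewrite ZE// bilinDl bilinZl (bilinC (V y) _ (Gsym Uy)) XV0// mulr0 addr0.
have := codiff_compat oU Gs Gsym Gu (V y) Xs Xs Uy.
rewrite Xbasic// [X in _ + X](bilinC _ _ (Gsym Uy)) => /eqP.
by rewrite eq_sym -mulr2n mulrn_eq0 /= => /eqP.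
Qed.

Let muE y : U y -> mu y = - bilin (G y) (field_accel y) (X y).
Proof.
move=> Uy; have := codiff_unit_orthogonal (X y) Uy.
rewrite -/(Z y) ZE// bilinDl bilinZl Vunit// mulrN1 => /eqP; rewrite subr_eq0 => /eqP <-.
have := codiff_compat oU Gs Gsym Gu (V y) Xs Vs Uy.
rewrite (derive_const_on _ oU XV0 Uy) => /eqP.
by rewrite eq_sym addr_eq0 => /eqP ->; rewrite (bilinC _ _ (Gsym Uy)).
Qed.

Let Zs : smooth_mx U Z.
Proof. by apply: smooth_mxM => //; exact: smooth_codiff. Qed.

Let curvE x : U x -> curvature_at G x (X x) (V x) (V x) =
  X x *m codiff G field_accel x - V x *m codiff G Z x - mu x *: field_accel x.
Proof.
move=> Ux; have Ns := smooth_field_accel.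
rewrite -(codiff_curvature oU Gs Gsym Gu (X x) (V x) Vs Ux).
rewrite (codiffE G (X x) Ns Ux) (codiffE G (V x) Zs Ux).
have Vd := smooth_mx_differentiable Vs Ux.
have Xd := smooth_mx_differentiable Xs Ux.
have Cd := smooth_mx_differentiable (smooth_codiff oU Gs Gu Vs) Ux.
rewrite (derive_mulmx (X x) Vd Cd) (derive_mulmx (V x) Xd Cd).
have : 'D_(X x) V x *m codiff G V x - 'D_(V x) X x *m codiff G V x = mu x *: field_accel x.
  by rewrite /field_accel scalemxAl -brXV// -mulmxBl.
rewrite -/(field_accel x) -/(Z x).
move: ('D_(X x) V x *m _) ('D_(V x) X x *m _) (mu x *: _) => a b c <-.
move: (V x *m _) (X x *m _) (gamma _ _ _ (Z x)) (gamma _ _ _ _) => p q r s.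
by rewrite -(addrA a) -(addrA b) (opprD b) (addrACA a) [RHS]addrAC subrr add0r.
Qed.

(** With Z = nabla_X V: Z is orthogonal to V because V is unit, and to X because
    X is basic, i.e. [X, V] is vertical and |X| is constant along V. Hence
    <nabla_V Z, X> = - <Z, nabla_V X> = - <Z, Z>, and since [X, V] = mu V with
    mu = - <nabla_V V, X>, the three terms of R(X, V)V = nabla_X nabla_V V
    - nabla_V Z - nabla_[X,V] V contribute the three terms on the right. *)
Lemma mixed_curvatureE x : U x ->
  bilin (G x) (curvature_at G x (X x) (V x) (V x)) (X x) =
  bilin (G x) (X x *m codiff G field_accel x) (X x)
  + bilin (G x) (X x *m codiff G V x) (X x *m codiff G V x)
  + bilin (G x) (field_accel x) (X x) ^+ 2.
Proof.
move=> Ux; rewrite curvE// !bilinBl bilinZl (muE Ux) mulNr opprK -expr2.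
congr (_ + _ + _).
have := codiff_compat oU Gs Gsym Gu (V x) Zs Xs Ux.
rewrite (derive_const_on _ oU ZX0 Ux) => /esym/eqP.
rewrite addr_eq0 => /eqP ->; rewrite opprK -/(Z x).
have -> : V x *m codiff G X x = Z x - mu x *: V x by rewrite ZE// addrK.
by rewrite bilinBr bilinZr codiff_unit_orthogonal// mulr0 subr0.
Qed.

End MixedCurvature.

(** * Submersions with timelike one-dimensional fibres, in charts *)

(** Projection to the base of the acceleration of a fibre with velocity T: minus
    the second fundamental form of the submersion on (T, T). Unlike nabla_V V,
    it involves no derivative of the vertical field, so that it can be evaluated
    at a single vector. *)
Definition fibre_accel (R : realType) m n (G : 'rV[R]_m -> 'M[R]_m)
    (phi : 'rV[R]_m -> 'rV[R]_n) (T y : 'rV[R]_m) : 'rV[R]_n :=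
  gamma G y T T *m 'J phi y - 'D_T ('D_T phi) y.

(** Of the geometry of the submersion, this section retains two pointwise facts:
    [cometric], which is established in [submersion_cometric], and [fibre1], in
    [fibre_one_dimensional]. *)
Section SubmersionInCharts.
Variables (R : realType) (m n : nat).
Variables (U : set 'rV[R]_m) (U' : set 'rV[R]_n).
Variables (G : 'rV[R]_m -> 'M[R]_m) (phi : 'rV[R]_m -> 'rV[R]_n) (h : 'rV[R]_n -> 'M[R]_n).
Hypothesis oU : open U.
Hypothesis Gs : smooth_mx U G.
Hypothesis Gsym : forall x, U x -> (G x)^T = G x.
Hypothesis Gu : forall x, U x -> G x \in unitmx.
Hypothesis phis : smooth_mx U phi.
Hypothesis phiU : forall x, U x -> U' (phi x).
Hypothesis hs : smooth_mx U' h.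
Hypothesis hpos : forall z, U' z -> forall u : 'rV[R]_n, u != 0 -> 0 < bilin (h z) u u.
Hypothesis cometric : forall x, U x ->
  ('J phi x)^T *m invmx (G x) *m 'J phi x *m h (phi x) = 1%:M.
Hypothesis fibre1 : forall x, U x -> forall T v : 'rV[R]_m, T *m 'J phi x = 0 -> T != 0 ->
  v *m 'J phi x = 0 -> exists a, v = a *: T.

(** The horizontal lift of the base vector w: the g-gradient of the function
    h(w, phi) with h frozen at the image point. *)
Definition hlift (w : 'rV[R]_n) (x : 'rV[R]_m) : 'rV[R]_m :=
  w *m h (phi x) *m ('J phi x)^T *m invmx (G x).

Lemma hlift_jacobian w x : U x -> hlift w x *m 'J phi x = w.
Proof.
move=> Ux; transitivity (w *m (h (phi x) *m (('J phi x)^T *m invmx (G x) *m 'J phi x))).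
  by rewrite /hlift !mulmxA.
by rewrite (mulmx1C (cometric Ux)) mulmx1.
Qed.

Lemma hlift_orthogonal w x v : U x -> v *m 'J phi x = 0 -> bilin (G x) (hlift w x) v = 0.
Proof.
move=> Ux vJ; rewrite /bilin /hlift (mulmxKV (Gu Ux)) -mulmxA -trmx_mul vJ.
by rewrite trmx0 mulmx0 mxE.
Qed.

Lemma bilin_hlift w w' x : U x ->
  bilin (G x) (hlift w x) (hlift w' x) = bilin (h (phi x)) w w'.
Proof.
move=> Ux; rewrite /bilin {1}/hlift (mulmxKV (Gu Ux)) -mulmxA -trmx_mul.
by rewrite hlift_jacobian.
Qed.

Variable (U0 : set 'rV[R]_m) (V : 'rV[R]_m -> 'rV[R]_m).
Hypothesis oU0 : open U0.
Hypothesis U0U : U0 `<=` U.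
Hypothesis Vs : smooth_mx U0 V.
Hypothesis Vunit : forall y, U0 y -> bilin (G y) (V y) (V y) = -1.
Hypothesis Vvert : forall y, U0 y -> V y *m 'J phi y = 0.

Lemma V_neq0 y : U0 y -> V y != 0.
Proof.
move=> Uy; apply/eqP => V0; have := Vunit Uy; rewrite V0 bilin0l => /eqP.
by rewrite eq_sym oppr_eq0 oner_eq0.
Qed.

Lemma horizontal_lift y u : U0 y -> bilin (G y) u (V y) = 0 ->
  u = hlift (u *m 'J phi y) y.
Proof.
move=> U0y uV; have Uy := U0U U0y; apply/eqP; rewrite -subr_eq0; apply/eqP.
set v := u - _.
have vJ : v *m 'J phi y = 0 by rewrite mulmxBl hlift_jacobian// subrr.
have vV : bilin (G y) v (V y) = 0.
  by rewrite bilinBl uV hlift_orthogonal ?subr0//; exact: Vvert.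
apply: (bilin_nondeg (Gu Uy)) => w; rewrite bilin0l.
pose w' := w - hlift (w *m 'J phi y) y.
have w'J : w' *m 'J phi y = 0 by rewrite mulmxBl hlift_jacobian// subrr.
have [a w'E] := fibre1 Uy (Vvert U0y) (V_neq0 U0y) w'J.
have -> : w = w' + hlift (w *m 'J phi y) y by rewrite subrK.
rewrite bilinDr w'E bilinZr vV mulr0 add0r (bilinC _ _ (Gsym Uy)).
exact: hlift_orthogonal.
Qed.

(** The submersion is an isometry on horizontal vectors, so these are spacelike. *)
Lemma bilin_horizontal y u : U0 y -> bilin (G y) u (V y) = 0 ->
  bilin (G y) u u = bilin (h (phi y)) (u *m 'J phi y) (u *m 'J phi y).
Proof.
move=> U0y uV; rewrite {1 2}(horizontal_lift U0y uV) bilin_hlift//; exact: U0U.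
Qed.

Lemma bilin_base_ge0 y w : U0 y -> 0 <= bilin (h (phi y)) w w.
Proof.
move=> U0y; have [->|w0] := eqVneq w 0; first by rewrite bilin0l.
by apply/ltW/hpos => //; apply: phiU; exact: U0U.
Qed.

Lemma bilin_base_eq0 y w : U0 y -> bilin (h (phi y)) w w <= 0 -> w = 0.
Proof.
move=> U0y; have [->//|w0] := eqVneq w 0; rewrite leNgt hpos//.
by apply: phiU; exact: U0U.
Qed.

Let phis0 := smooth_mx_sub U0U phis.
Let Gs0 := smooth_mx_sub U0U Gs.
Let Gsym0 y (U0y : U0 y) := Gsym (U0U U0y).
Let Gu0 y (U0y : U0 y) := Gu (U0U U0y).

Lemma smooth_hlift w : smooth_mx U0 (hlift w).
Proof.
have Js := smooth_jacobian oU0 phis0.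
apply: smooth_mxM => //; last exact: smooth_mxV.
apply: smooth_mxM => //; last exact: smooth_mx_tr.
apply: smooth_mxM => //; first exact: smooth_mx_cst.
by apply: (smooth_mx_comp oU0 _ phis0 hs) => x /U0U; exact: phiU.
Qed.

Lemma hlift_basic w y : U0 y ->
  'D_(V y) (fun z => bilin (G z) (hlift w z) (hlift w z)) y = 0.
Proof.
move=> U0y; have Uy := U0U U0y.
have E z : U0 z -> bilin (G z) (hlift w z) (hlift w z) = bilin (h (phi z)) w w.
  by move=> /U0U; exact: bilin_hlift.
rewrite (derive_eq_on oU0 _ E U0y).
have phid := smooth_mx_differentiable phis0 U0y.
have hd : differentiable (fun z => bilin (h z) w w) (phi y).
  apply: differentiable_bilin_mx; try exact: differentiable_cst.
  exact: smooth_mx_differentiable hs (phiU Uy).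
rewrite (derive_compE (V y) phid hd) (derive_jacobian phis0)// Vvert//.
exact: derive0.
Qed.

(** The lift is phi-related to a constant field and V to 0, so their bracket is
    phi-related to 0, i.e. vertical; the fibres are one-dimensional. *)
Lemma hlift_bracket w : exists mu, forall y, U0 y -> lie_bracket (hlift w) V y = mu y *: V y.
Proof.
have E y : exists a, U0 y -> lie_bracket (hlift w) V y = a *: V y.
  have [U0y|nU0y] := pselect (U0 y); last by exists 0.
  have Uy := U0U U0y.
  suff : lie_bracket (hlift w) V y *m 'J phi y = 0.
    by move=> /(fibre1 Uy (Vvert U0y) (V_neq0 U0y))[a aE]; exists a.
  have Jd := smooth_mx_differentiable (smooth_jacobian oU0 phis0) U0y.
  have Vd := smooth_mx_differentiable Vs U0y.
  have Ld := smooth_mx_differentiable (smooth_hlift w) U0y.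
  have VJ : 'D_(hlift w y) (fun z => V z *m 'J phi z) y = 0.
    exact: derive_const_on oU0 Vvert U0y.
  have LJ : 'D_(V y) (fun z => hlift w z *m 'J phi z) y = 0.
    apply: (derive_const_on _ oU0 _ U0y) => z /U0U; exact: hlift_jacobian.
  rewrite (derive_mulmx _ Vd Jd) in VJ; rewrite (derive_mulmx _ Ld Jd) in LJ.
  rewrite mulmxBl; move/eqP: VJ; rewrite addr_eq0 => /eqP ->.
  move/eqP: LJ; rewrite addr_eq0 => /eqP ->.
  rewrite !(mulmx_derive_jacobian oU0 phis0)//.
  rewrite opprK addrC; apply/eqP; rewrite subr_eq0; apply/eqP.
  exact: (smooth_mx_derive_comm oU0 _ _ phis0 U0y).
by have [mu muE] := choice E; exists mu.
Qed.

Lemma field_accel_orthogonal y : U0 y -> bilin (G y) (field_accel G V y) (V y) = 0.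
Proof. by move=> U0y; apply: (codiff_unit_orthogonal oU0 Gs0 Gsym0 Gu0 Vs Vunit). Qed.

(** Differentiate the relation V *m 'J phi = 0 along V. *)
Lemma field_accel_jacobian y : U0 y ->
  field_accel G V y *m 'J phi y = fibre_accel G phi (V y) y.
Proof.
move=> U0y; rewrite /field_accel (codiffE G (V y) Vs U0y) mulmxDl addrC.
rewrite /fibre_accel; congr (_ + _).
have Jd := smooth_mx_differentiable (smooth_jacobian oU0 phis0) U0y.
have Vd := smooth_mx_differentiable Vs U0y.
have VJ : 'D_(V y) (fun z => V z *m 'J phi z) y = 0.
  exact: derive_const_on oU0 Vvert U0y.
move/eqP: VJ; rewrite (derive_mulmx _ Vd Jd) addr_eq0 => /eqP ->.
by rewrite (mulmx_derive_jacobian oU0 phis0).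
Qed.

Lemma field_accel_norm y : U0 y -> bilin (G y) (field_accel G V y) (field_accel G V y) =
  bilin (h (phi y)) (fibre_accel G phi (V y) y) (fibre_accel G phi (V y) y).
Proof.
move=> U0y; rewrite bilin_horizontal ?field_accel_jacobian//.
exact: field_accel_orthogonal.
Qed.

(** In [mixed_curvatureE] the field nabla_X V is orthogonal to V, hence spacelike. *)
Lemma mixed_curvature_nonneg x w : U0 x ->
  0 <= bilin (G x) (hlift w x *m codiff G (field_accel G V) x) (hlift w x) ->
  0 <= bilin (G x) (curvature_at G x (hlift w x) (V x) (V x)) (hlift w x).
Proof.
move=> U0x; have [mu muE] := hlift_bracket w.
have XV0 y : U0 y -> bilin (G y) (hlift w y) (V y) = 0.
  by move=> U0y; apply: hlift_orthogonal; [exact: U0U|exact: Vvert].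
rewrite (mixed_curvatureE oU0 Gs0 Gsym0 Gu0 Vs (smooth_hlift w) Vunit XV0 (hlift_basic w) muE U0x).
move=> N0; apply: addr_ge0; last exact: sqr_ge0.
apply: addr_ge0 => //; rewrite bilin_horizontal//; first exact: bilin_base_ge0.
exact: (codiff_unit_orthogonal oU0 Gs0 Gsym0 Gu0 Vs Vunit).
Qed.

(** The maximum principle. Let N be the acceleration of the fibres and x a maximum
    of <N, N>. If N x is nonzero, it is the value of a basic field X, and
    <nabla_X N, X> is half the derivative of <N, N> along N x, which is 0. If
    N x = 0, then <N, N> <= 0 and N vanishes around x, because it is horizontal
    and horizontal vectors are spacelike. Either way <nabla_X N, X> = 0 for some
    lift X <> 0, so that <R(X, V)V, X> is nonnegative. *)
Lemma accel_max_impossible x (w1 : 'rV[R]_n) : U0 x -> w1 != 0 ->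
  (forall y, U0 y ->
    bilin (G y) (field_accel G V y) (field_accel G V y) <=
    bilin (G x) (field_accel G V x) (field_accel G V x)) ->
  (forall w, w != 0 ->
    bilin (G x) (curvature_at G x (hlift w x) (V x) (V x)) (hlift w x) < 0) ->
  False.
Proof.
move=> U0x w10 Nmax Kneg; pose N := field_accel G V.
have Ns : smooth_mx U0 N by exact: (smooth_field_accel oU0 Gs0 Gu0 Vs).
have nonneg w : w != 0 -> ~ 0 <= bilin (G x) (hlift w x *m codiff G N x) (hlift w x).
  move=> w0 /(mixed_curvature_nonneg U0x); rewrite leNgt => /negP; apply.
  exact: Kneg.
have [n0|n0] := eqVneq (N x *m 'J phi x) 0; last first.
  apply: (nonneg _ n0).
  rewrite -horizontal_lift//; last exact: field_accel_orthogonal.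
  have := derive_at_max (N x) oU0 U0x _ Nmax.
  move=> /(_ (fun y U0y => differentiable_bilin_mx (smooth_mx_differentiable Gs0 U0y)
    (smooth_mx_differentiable Ns U0y) (smooth_mx_differentiable Ns U0y))).
  rewrite (codiff_compat oU0 Gs0 Gsym0 Gu0 (N x) Ns Ns U0x).
  rewrite [X in _ + X](bilinC _ _ (Gsym0 U0x)) => /eqP.
  by rewrite -mulr2n mulrn_eq0 /= => /eqP ->.
have lift0 y : hlift 0 y = 0 by rewrite /hlift !mul0mx.
have Nx0 : N x = 0.
  apply: etrans (horizontal_lift U0x (field_accel_orthogonal U0x)) _.
  by rewrite -/(N x) n0 lift0.
have N0 y : U0 y -> N y = 0.
  move=> U0y; have No := field_accel_orthogonal U0y.
  apply: etrans (horizontal_lift U0y No) _.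
  rewrite (bilin_base_eq0 (w := field_accel G V y *m 'J phi y) U0y) ?lift0//.
  by rewrite -bilin_horizontal//; have := Nmax y U0y; rewrite -/(N x) Nx0 bilin0l.
apply: (nonneg _ w10).
rewrite (codiffE G _ Ns U0x) (derive_const_on _ oU0 N0 U0x) Nx0.
by rewrite (gamma_sym oU0 Gs0 Gsym0 _ _ U0x) gamma_conn mul0mx addr0 bilin0l.
Qed.

End SubmersionInCharts.

Section UnitVerticalField.
Variables (R : realType) (m n : nat).
Variables (U : set 'rV[R]_m) (U' : set 'rV[R]_n).
Variables (G : 'rV[R]_m -> 'M[R]_m) (phi : 'rV[R]_m -> 'rV[R]_n) (h : 'rV[R]_n -> 'M[R]_n).
Hypothesis oU : open U.
Hypothesis Gs : smooth_mx U G.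
Hypothesis Gu : forall x, U x -> G x \in unitmx.
Hypothesis phis : smooth_mx U phi.
Hypothesis phiU : forall x, U x -> U' (phi x).
Hypothesis hs : smooth_mx U' h.
Hypothesis cometric : forall x, U x ->
  ('J phi x)^T *m invmx (G x) *m 'J phi x *m h (phi x) = 1%:M.

(** Extend T0 to a constant field, project it to the vertical space and
    normalize; the projection stays timelike near x0. *)
Lemma exists_unit_vertical_field x0 (T0 : 'rV[R]_m) : U x0 -> T0 *m 'J phi x0 = 0 ->
  bilin (G x0) T0 T0 < 0 ->
  exists (U0 : set 'rV[R]_m) (V : 'rV[R]_m -> 'rV[R]_m),
  [/\ open U0, U0 `<=` U, U0 x0, smooth_mx U0 V &
     forall y, U0 y -> bilin (G y) (V y) (V y) = -1 /\ V y *m 'J phi y = 0].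
Proof.
move=> Ux0 T0J T0neg.
have Js := smooth_jacobian oU phis.
pose W y := T0 - T0 *m 'J phi y *m h (phi y) *m ('J phi y)^T *m invmx (G y).
have Ws : smooth_mx U W.
  apply: smooth_mxD => //; first exact: smooth_mx_cst.
  apply: smooth_mxN => //; apply: smooth_mxM => //; last exact: smooth_mxV.
  apply: smooth_mxM => //; last exact: smooth_mx_tr.
  apply: smooth_mxM => //; last exact: (smooth_mx_comp oU phiU phis hs).
  by apply: smooth_mxM => //; exact: smooth_mx_cst.
have WJ y : U y -> W y *m 'J phi y = 0.
  move=> Uy; rewrite mulmxBl -[X in _ - X *m _]/(hlift G phi h (T0 *m 'J phi y) y).
  by rewrite (hlift_jacobian cometric) ?subrr.
have W0 : W x0 = T0 by rewrite /W T0J !mul0mx subr0.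
pose l y := - bilin (G y) (W y) (W y).
have ls : smoothf U l by apply: smoothfN => //; exact: smoothf_bilin.
pose U0 := [set y | U y /\ 0 < l y].
have oU0 : open U0.
  rewrite openE => y [Uy ly]; rewrite /interior.
  apply: filterI; first exact: open_nbhs_nbhs.
  have lc : l z @[z --> y] --> l y by exact: (ls 0%N).
  exact: cvgr_gt lc _ ly.
have U0U : U0 `<=` U by move=> y [].
pose V y := (Num.sqrt (l y))^-1 *: W y.
have U0x0 : U0 x0 by split=> //; rewrite /l W0 oppr_gt0.
have Vs : smooth_mx U0 V.
  apply: smooth_mxZ => //; last exact: smooth_mx_sub U0U Ws.
  apply: smoothfV => //; first by move=> y [_ ly]; rewrite gt_eqF// sqrtr_gt0.
  apply: smoothf_sqrt => //; first by move=> y [].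
  by move=> k; apply: diffn_sub U0U _; exact: ls.
have Vprop y : U0 y -> bilin (G y) (V y) (V y) = -1 /\ V y *m 'J phi y = 0.
  move=> [Uy ly]; split; last by rewrite -scalemxAl WJ// scaler0.
  have -> : bilin (G y) (V y) (V y) = - ((Num.sqrt (l y))^-1 ^+ 2 * l y).
    by rewrite /V bilinZl bilinZr /l mulrN opprK expr2 mulrA.
  by rewrite exprVn sqr_sqrtr ?ltW// mulVf// gt_eqF.
exists U0, V; split; [exact: oU0|exact: U0U|exact: U0x0|exact: Vs|exact: Vprop].
Qed.

End UnitVerticalField.

(** * Change of charts *)

Section Composition.
Variables (R : realType) (m n p : nat).
Variables (U : set 'rV[R]_m) (U1 : set 'rV[R]_n).
Variables (tau : 'rV[R]_m -> 'rV[R]_n) (F : 'rV[R]_n -> 'rV[R]_p).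
Hypothesis oU : open U.
Hypothesis oU1 : open U1.
Hypothesis taus : smooth_mx U tau.
Hypothesis tauU : forall y, U y -> U1 (tau y).
Hypothesis Fs : smooth_mx U1 F.

Lemma derive_comp_jacobian x u : U x ->
  'D_u (fun y => F (tau y)) x = 'D_u tau x *m 'J F (tau x).
Proof.
move=> Ux; rewrite (derive_compE u (smooth_mx_differentiable taus Ux)).
  by rewrite (derive_jacobian Fs)//; exact: tauU.
exact: smooth_mx_differentiable Fs (tauU Ux).
Qed.

Lemma derive2_comp x T : U x ->
  'D_T ('D_T (fun y => F (tau y))) x =
  'D_('D_T tau x) ('D_('D_T tau x) F) (tau x) + 'D_T ('D_T tau) x *m 'J F (tau x).
Proof.
move=> Ux.
have Js := smooth_jacobian oU1 Fs.
have Jtd : differentiable (fun y => jacobian F (tau y)) x.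
  apply: smooth_mx_differentiable Ux; exact: (smooth_mx_comp oU tauU taus Js).
have Dtd := smooth_mx_differentiable (smooth_mx_derive oU T taus) Ux.
rewrite (derive_eq_on oU _ (fun y Uy => derive_comp_jacobian T Uy) Ux).
rewrite (derive_mulmx T Dtd Jtd) addrC; congr (_ + _).
rewrite (derive_compE T (smooth_mx_differentiable taus Ux)).
  by rewrite (mulmx_derive_jacobian oU1 Fs)//; exact: tauU.
exact: smooth_mx_differentiable Js (tauU Ux).
Qed.

End Composition.

Section GammaTransition.
Variables (R : realType) (m : nat).
Variables (U U1 : set 'rV[R]_m) (tau : 'rV[R]_m -> 'rV[R]_m).
Variables (G G1 : 'rV[R]_m -> 'M[R]_m).
Hypothesis oU : open U.
Hypothesis oU1 : open U1.
Hypothesis taus : smooth_mx U tau.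
Hypothesis tauU : forall y, U y -> U1 (tau y).
Hypothesis Gs : smooth_mx U G.
Hypothesis Gsym : forall x, U x -> (G x)^T = G x.
Hypothesis Gu : forall x, U x -> G x \in unitmx.
Hypothesis G1s : smooth_mx U1 G1.
Hypothesis G1sym : forall x, U1 x -> (G1 x)^T = G1 x.
Hypothesis G1u : forall x, U1 x -> G1 x \in unitmx.
Hypothesis GE : forall y, U y -> G y = 'J tau y *m G1 (tau y) *m ('J tau y)^T.

Lemma derive_metric_transition x a b c : U x ->
  bilin ('D_a G x) b c =
  bilin ('D_(a *m 'J tau x) G1 (tau x)) (b *m 'J tau x) (c *m 'J tau x)
  + bilin (G1 (tau x)) ('D_a ('D_b tau) x) (c *m 'J tau x)
  + bilin (G1 (tau x)) (b *m 'J tau x) ('D_a ('D_c tau) x).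
Proof.
move=> Ux.
have cd (e : 'rV[R]_m) : differentiable (fun _ : 'rV[R]_m => e) x by exact: differentiable_cst.
have Gd := smooth_mx_differentiable Gs Ux.
have -> : bilin ('D_a G x) b c = 'D_a (fun y => bilin (G y) b c) x.
  by rewrite (derive_bilin a Gd (cd b) (cd c)) !derive_cst bilin0l bilin0r !addr0.
have E y : U y -> bilin (G y) b c = bilin (G1 (tau y)) ('D_b tau y) ('D_c tau y).
  by move=> Uy; rewrite GE// bilin_congr !(derive_jacobian taus).
rewrite (derive_eq_on oU a E Ux).
have td := smooth_mx_differentiable taus Ux.
have G1d := smooth_mx_differentiable G1s (tauU Ux).
have Dd e := smooth_mx_differentiable (smooth_mx_derive oU e taus) Ux.
have G1td : differentiable (fun y => G1 (tau y)) x by exact: differentiable_comp td G1d.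
rewrite (derive_bilin a G1td (Dd b) (Dd c)) (derive_compE a td G1d).
by rewrite !(derive_jacobian taus _ Ux).
Qed.

Lemma jacobian_unit x : U x -> 'J tau x \in unitmx.
Proof.
by move=> Ux; have := Gu Ux; rewrite GE// !unitmx_mul => /andP[/andP[]].
Qed.

(** The transformation law of the Christoffel symbols, on the diagonal. Take
    [derive_metric_transition] in Koszul's formula: of the second derivatives of
    tau, only the one along T, T survives, by symmetry. *)
Lemma gamma_transition x T : U x ->
  gamma G1 (tau x) (T *m 'J tau x) (T *m 'J tau x) =
  gamma G x T T *m 'J tau x - 'D_T ('D_T tau) x.
Proof.
move=> Ux; have U1t := tauU Ux.
apply: (bilin_nondeg (G1u U1t)) => w'.
pose w := w' *m invmx ('J tau x).
have -> : w' = w *m 'J tau x by rewrite mulmxKV// jacobian_unit.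
have two0 : (2 : R) != 0 by rewrite pnatr_eq0.
apply: (mulfI two0); rewrite bilinBl mulrBr -bilin_congr -GE//.
have alg (x' y b1 b2 c1 c2 d e e' e'' : R) : x' = b1 + b1 - b2 ->
    y = c1 + c1 - c2 -> b1 = c1 + d + e -> b2 = c2 + e' + e'' ->
    e' = e -> e'' = e -> y = x' - 2 * d.
  by move=> -> -> -> -> -> ->; ring.
have comm := smooth_mx_derive_comm oU T w taus Ux.
have M := gamma_metric Gs Gsym Gu T T w Ux.
have M1 := gamma_metric G1s G1sym G1u (T *m 'J tau x) (T *m 'J tau x) (w *m 'J tau x) U1t.
have D := derive_metric_transition T T w Ux.
have D' := derive_metric_transition w T T Ux.
have e1 : bilin (G1 (tau x)) ('D_w ('D_T tau) x) (T *m 'J tau x) =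
    bilin (G1 (tau x)) (T *m 'J tau x) ('D_T ('D_w tau) x).
  by rewrite (bilinC _ _ (G1sym U1t)) comm.
have e2 : bilin (G1 (tau x)) (T *m 'J tau x) ('D_w ('D_T tau) x) =
    bilin (G1 (tau x)) (T *m 'J tau x) ('D_T ('D_w tau) x).
  by rewrite comm.
exact: alg M M1 D D' e1 e2.
Qed.

End GammaTransition.

Section FibreAccelTransition.
Variables (R : realType) (m n : nat).
Variables (U U1 : set 'rV[R]_m) (W : set 'rV[R]_n).
Variables (G G1 : 'rV[R]_m -> 'M[R]_m).
Variables (tau : 'rV[R]_m -> 'rV[R]_m) (sigma : 'rV[R]_n -> 'rV[R]_n).
Variables (phi phi1 : 'rV[R]_m -> 'rV[R]_n).
Hypothesis oU : open U.
Hypothesis oU1 : open U1.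
Hypothesis oW : open W.
Hypothesis taus : smooth_mx U tau.
Hypothesis tauU : forall y, U y -> U1 (tau y).
Hypothesis Gs : smooth_mx U G.
Hypothesis Gsym : forall x, U x -> (G x)^T = G x.
Hypothesis Gu : forall x, U x -> G x \in unitmx.
Hypothesis G1s : smooth_mx U1 G1.
Hypothesis G1sym : forall x, U1 x -> (G1 x)^T = G1 x.
Hypothesis G1u : forall x, U1 x -> G1 x \in unitmx.
Hypothesis GE : forall y, U y -> G y = 'J tau y *m G1 (tau y) *m ('J tau y)^T.
Hypothesis phis : smooth_mx U phi.
Hypothesis phiW : forall y, U y -> W (phi y).
Hypothesis phi1s : smooth_mx U1 phi1.
Hypothesis sigmas : smooth_mx W sigma.
Hypothesis phiE : forall y, U y -> phi1 (tau y) = sigma (phi y).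

Lemma jacobian_square x : U x ->
  'J tau x *m 'J phi1 (tau x) = 'J phi x *m 'J sigma (phi x).
Proof.
move=> Ux; apply/row_matrixP => i; rewrite !rowE !mulmxA.
rewrite -(derive_jacobian taus (delta_mx 0 i) Ux) -(derive_jacobian phis (delta_mx 0 i) Ux).
have E := derive_comp_jacobian taus tauU phi1s (delta_mx 0 i) Ux.
have E' := derive_comp_jacobian phis phiW sigmas (delta_mx 0 i) Ux.
apply: etrans (esym E) (etrans _ E').
exact: (derive_eq_on oU _ phiE Ux).
Qed.

(** The acceleration is a vector of the base: gamma and the second derivative of
    the representative of the map change by the same second derivative of tau,
    and the second derivative of sigma drops out because T is vertical. *)
Lemma fibre_accel_transition x T : U x -> T *m 'J phi x = 0 ->
  fibre_accel G1 phi1 (T *m 'J tau x) (tau x) =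
  fibre_accel G phi T x *m 'J sigma (phi x).
Proof.
move=> Ux TJ; rewrite /fibre_accel.
rewrite (gamma_transition oU taus tauU Gs Gsym Gu G1s G1sym G1u GE T Ux).
have E := derive2_comp oU oU1 taus tauU phi1s T Ux.
have E' := derive2_comp oU oW phis phiW sigmas T Ux.
rewrite (derive_jacobian taus _ Ux) in E.
rewrite (derive_jacobian phis _ Ux) TJ derive0 add0r in E'.
have E1 y (Uy : U y) := derive_eq_on oU T phiE Uy.
have EE := derive_eq_on oU T E1 Ux.
have alg (g dt : 'rV[R]_m) (Jt : 'M[R]_m) (J1 J : 'M[R]_(m, n)) (Js : 'M[R]_n)
    (p q e f : 'rV[R]_n) : Jt *m J1 = J *m Js -> e = p + dt *m J1 -> f = q *m Js ->
    e = f -> (g *m Jt - dt) *m J1 - p = (g *m J - q) *m Js.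
  by move=> JE -> -> pq; rewrite !mulmxBl -!mulmxA JE -pq opprD addrA addrAC.
exact: alg (jacobian_square Ux) E E' EE.
Qed.

End FibreAccelTransition.

(** * Semi-Riemannian submersions onto a Riemannian base *)

Section ChartDomains.
Variables (R : realType) (T : topologicalType) (m : nat).
Implicit Types (c d : chart R T m).

Definition chart_image c (A : set T) : set 'rV[R]_m :=
  [set y | cimg c y /\ A (cfrom c y)].

Lemma open_chart_image c A : open A -> open (chart_image c A).
Proof.
move=> oA; rewrite openE => y [cy Ay]; rewrite /interior.
have cy_nbhs : nbhs y (cimg c).
  by apply: open_nbhs_nbhs; split => //; exact: open_cimg.
have Ay_nbhs : nbhs y (cfrom c @^-1` A).
  by apply: (cfrom_continuous cy); exact: open_nbhs_nbhs.
exact: filterI cy_nbhs Ay_nbhs.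
Qed.

Lemma image_chartE c A : cto c @` (cdom c `&` A) = chart_image c A.
Proof.
apply/seteqP; split => [y [p [cp Ap] <-]|y [cy Ay]].
  by split; [exact: cto_img|rewrite ctoK].
exists (cfrom c y); last exact: cfromK.
by split => //; exact: cfrom_dom.
Qed.

Lemma overlapE c d : overlap c d = chart_image c (cdom d).
Proof. exact: image_chartE. Qed.

Lemma chart_image_cto c (A : set T) p : cdom c p -> A p -> chart_image c A (cto c p).
Proof. by move=> cp Ap; split; [exact: cto_img|rewrite ctoK]. Qed.

End ChartDomains.

Section Submersion.
Variables (R : realType) (n : nat) (B : manifold R n) (M : manifold R n.+1).
Variables (gB : metric B) (gM : metric M) (pi : M -> B).
Hypothesis B_riemannian : riemannian gB.
Hypothesis M_index1 : metric_index gM 1.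
Hypothesis pi_subm : semi_riemannian_submersion gM gB pi.

Implicit Types (c : chart R M n.+1) (d : chart R B n) (p : M).

Definition subm_dom c d := chart_image c (pi @^-1` cdom d).

Let pi_continuous : continuous pi := (subm_smooth pi_subm).1.

Lemma open_pi_cdom d : open (pi @^-1` cdom d).
Proof. by move/continuousP : pi_continuous; apply; exact: open_cdom. Qed.

Lemma open_subm_dom c d : open (subm_dom c d).
Proof. apply: open_chart_image; exact: open_pi_cdom. Qed.

Lemma smooth_local_rep c d : atlas c -> atlas d ->
  smooth_mx (subm_dom c d) (local_rep pi c d).
Proof.
move=> ac ad; apply: smooth_mx_of_smooth_on; first exact: open_subm_dom.
by have := (subm_smooth pi_subm).2 c d ac ad; rewrite image_chartE.
Qed.

Lemma local_rep_cimg c d y : subm_dom c d y -> cimg d (local_rep pi c d y).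
Proof. by move=> [_ dy]; exact: cto_img. Qed.

Lemma smooth_gmx m (N : manifold R m) (g : metric N) (c : chart R N m) : atlas c ->
  smooth_mx (cimg c) (gmx g c).
Proof.
move=> ac; apply: smooth_mx_of_smooth_on; first exact: open_cimg.
exact: gmx_smooth.
Qed.

Lemma gmx_pos d z u : atlas d -> cimg d z -> u != 0 -> 0 < bilin (gmx gB d z) u u.
Proof.
move=> ad dz u0; have := B_riemannian (conj ad (cfrom_dom dz)) u0.
by rewrite /metric_at cfromK.
Qed.

Lemma gmx_base_ge0 d z u : atlas d -> cimg d z -> 0 <= bilin (gmx gB d z) u u.
Proof.
move=> ad dz; have [->|u0] := eqVneq u 0; first by rewrite bilin0l.
by rewrite ltW// gmx_pos.
Qed.

Lemma smooth_transition m (N : manifold R m) (c c' : chart R N m) : atlas c -> atlas c' ->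
  smooth_mx (chart_image c (cdom c')) (transition c c').
Proof.
move=> ac ac'; apply: smooth_mx_of_smooth_on.
  by apply: open_chart_image; exact: open_cdom.
by rewrite -overlapE; exact: (atlas_compatible ac ac').1.
Qed.

Lemma dom_chart_at c d y : atlas c -> atlas d -> subm_dom c d y ->
  chart_at c (cfrom c y) /\ chart_at d (pi (cfrom c y)).
Proof. by move=> ac ad [cy dy]; split; split => //; exact: cfrom_dom. Qed.

(** The representatives of pi in two charts of the base differ by a transition
    map of the base, so a vector killed by one Jacobian is killed by the other. *)
Lemma verticalE c d p u : chart_at c p -> chart_at d (pi p) ->
  u *m 'J (local_rep pi c d) (cto c p) = 0 -> vertical pi c p u.
Proof.
move=> [ac cp] [ad dp] uJ d' [ad' dp']; rewrite /differential.
pose U := chart_image c (pi @^-1` (cdom d `&` cdom d')).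
have oU : open U.
  apply: open_chart_image; rewrite preimage_setI.
  by apply: openI; exact: open_pi_cdom.
have Ux : U (cto c p) by apply: chart_image_cto.
have Ud : U `<=` subm_dom c d by move=> y [cy [dy _]].
have Ud' : U `<=` subm_dom c d' by move=> y [cy [_ dy]].
have ps := smooth_mx_sub Ud (smooth_local_rep ac ad).
have ps' := smooth_mx_sub Ud' (smooth_local_rep ac ad').
have UW y : U y -> chart_image d (cdom d') (local_rep pi c d y).
  by move=> [cy [dy dy']]; split; [exact: cto_img|rewrite /local_rep /= ctoK].
have E y : U y -> local_rep pi c d' y = transition d d' (local_rep pi c d y).
  by move=> [cy [dy dy']]; rewrite /transition /local_rep /= ctoK.
rewrite -(derive_jacobian ps' u Ux).
apply: etrans (derive_eq_on oU u E Ux) _.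
apply: etrans (derive_comp_jacobian ps UW (smooth_transition ad ad') u Ux) _.
by rewrite (derive_jacobian ps u Ux) uJ mul0mx.
Qed.

Section AtPoint.
Variables (c : chart R M n.+1) (d : chart R B n).
Hypotheses (ac : atlas c) (ad : atlas d).
Local Notation phi := (local_rep pi c d).
Local Notation G := (gmx gM c).
Local Notation h := (gmx gB d).

Lemma dom_gmx_sym y : subm_dom c d y -> (G y)^T = G y.
Proof. by move=> [cy _]; exact: gmx_sym. Qed.

Lemma dom_gmx_unit y : subm_dom c d y -> G y \in unitmx.
Proof. by move=> [cy _]; exact: gmx_nondegenerate. Qed.

Lemma dom_differential_onto y (w : 'rV[R]_n) : subm_dom c d y -> exists u, u *m 'J phi y = w.
Proof.
move=> Uy; have [cy dy] := dom_chart_at ac ad Uy.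
have [u uE] := subm_differential_onto pi_subm cy dy w; exists u.
by rewrite -uE /differential cfromK//; case: Uy.
Qed.

(** The inverse metric of M projects to the inverse metric of B. The vectors
    X_z = z J^T G^-1 are orthogonal to the kernel of J, so the isometry property
    reads A h A = A for A = J^T G^-1 J; and A is invertible, because a vector X_z
    that is also vertical vanishes, the fibres being nondegenerate. *)
Lemma submersion_cometric y : subm_dom c d y ->
  ('J phi y)^T *m invmx (G y) *m 'J phi y *m h (phi y) = 1%:M.
Proof.
move=> Uy; have [cy dy] := dom_chart_at ac ad Uy.
have Gu := dom_gmx_unit Uy; have Gsym := dom_gmx_sym Uy.
have yK : cto c (cfrom c y) = y by rewrite cfromK//; case: Uy.
set J := 'J phi y; pose A := J^T *m invmx (G y) *m J.
have invs : (invmx (G y))^T = invmx (G y) by rewrite trmx_inv Gsym.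
have As : A^T = A by rewrite /A !trmx_mul trmxK invs mulmxA.
pose X (z : 'rV[R]_n) := z *m J^T *m invmx (G y).
have XJ z : X z *m J = z *m A by rewrite /X /A !mulmxA.
have vJ v : vertical pi c (cfrom c y) v -> v *m J = 0.
  by move=> /(_ d dy); rewrite /differential yK.
have Xv z v : v *m J = 0 -> bilin (G y) (X z) v = 0.
  by move=> vJ0; rewrite /bilin /X mulmxKV// -mulmxA -trmx_mul vJ0 trmx0 mulmx0 mxE.
have Xh z : horizontal gM pi c (cfrom c y) (X z).
  by move=> v /vJ; rewrite /metric_at yK; exact: Xv.
have iso z z' : bilin (h (phi y)) (z *m A) (z' *m A) = bilin A z z'.
  have := subm_isometry pi_subm cy dy (Xh z) (Xh z').
  rewrite /differential /metric_at yK -/J !XJ -[cto d _]/(phi y) => ->.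
  by rewrite /bilin /X mulmxKV// trmx_mul invs trmx_mul trmxK /A !mulmxA.
have AhA : A *m h (phi y) *m A = A.
  apply/matrixP => i j; have := iso (delta_mx 0 i) (delta_mx 0 j).
  by rewrite -bilin_congr As !bilin_delta.
have Au : A \in unitmx.
  rewrite -row_free_unit; apply: inj_row_free => z zA.
  have Xz0 : X z = 0.
    apply: (subm_fibre_nondegenerate pi_subm cy).
      by apply: (verticalE cy dy); rewrite yK -/J XJ.
    by move=> v /vJ; rewrite /metric_at yK; exact: Xv.
  have zJ : z *m J^T = 0.
    by rewrite -(mulmxKV Gu (z *m J^T)) -/(X z) Xz0 mul0mx.
  apply/rowP => j; rewrite mxE.
  have [u uJ] := dom_differential_onto (delta_mx 0 j) Uy.
  have : (z *m J^T *m u^T) 0 0 = 0 by rewrite zJ mul0mx mxE.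
  by rewrite -mulmxA -trmx_mul uJ trmx_delta -colE mxE.
by rewrite -/A -(mulmxK Au (A *m _)) AhA mulmxV.
Qed.

Lemma fibre_one_dimensional y : subm_dom c d y -> forall T v : 'rV[R]_n.+1,
  T *m 'J phi y = 0 -> T != 0 -> v *m 'J phi y = 0 -> exists a, v = a *: T.
Proof.
move=> Uy T v TJ T0 vJ; set J := 'J phi y in TJ vJ *.
have rJ : \rank J = n.
  apply/eqP; apply/row_fullP.
  have /choice[u uE] i := dom_differential_onto (delta_mx 0 i) Uy.
  exists (\matrix_i u i); apply/row_matrixP => i.
  by rewrite row_mul rowK uE row1.
have Tk : (T <= kermx J)%MS by apply/sub_kermxP.
have vk : (v <= kermx J)%MS by apply/sub_kermxP.
have kT : (kermx J <= T)%MS.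
  by rewrite -(mxrank_leqif_sup Tk) mxrank_ker rJ rank_rV T0 subSnn.
by apply/sub_rVP; exact: submx_trans kT.
Qed.

(** Take any timelike vector; its horizontal part is spacelike, so the vertical
    part is timelike. *)
Lemma exists_timelike_vertical y : subm_dom c d y ->
  exists2 T0 : 'rV[R]_n.+1, T0 *m 'J phi y = 0 & bilin (G y) T0 T0 < 0.
Proof.
move=> Uy; have [cy dy] := dom_chart_at ac ad Uy.
have yK : cto c (cfrom c y) = y by rewrite cfromK//; case: Uy.
have [[W Wneg rW] _] := M_index1 cy; rewrite yK in Wneg.
have nzW : nz_row W != 0 by rewrite nz_row_eq0 -mxrank_eq0 rW.
have := Wneg _ (nz_row_sub W) nzW; set u := nz_row W => uneg.
pose l := hlift G phi h (u *m 'J phi y) y.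
have lJ : l *m 'J phi y = u *m 'J phi y.
  by rewrite /l (hlift_jacobian submersion_cometric _ Uy).
pose T0 := u - l.
have T0J : T0 *m 'J phi y = 0 by rewrite mulmxBl lJ subrr.
exists T0 => //; apply: le_lt_trans uneg.
have uE : u = T0 + l by rewrite subrK.
have lT : bilin (G y) l T0 = 0 by exact: (hlift_orthogonal h dom_gmx_unit _ Uy T0J).
have -> : bilin (G y) u u = bilin (G y) T0 T0 + bilin (G y) l l.
  have Gsym := dom_gmx_sym Uy; move: (T0) (l) lT uE => T1 l1 lT ->.
  by rewrite bilinDl !bilinDr (bilinC T1 l1 Gsym) lT addr0 add0r.
rewrite /l (bilin_hlift dom_gmx_unit submersion_cometric _ _ Uy) lerDl.
by apply: gmx_base_ge0 => //; exact: local_rep_cimg.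
Qed.

Lemma exists_dom_unit_vertical_field x0 : subm_dom c d x0 ->
  exists (U0 : set 'rV[R]_n.+1) (V : 'rV[R]_n.+1 -> 'rV[R]_n.+1),
  [/\ open U0, U0 `<=` subm_dom c d, U0 x0, smooth_mx U0 V &
     forall y, U0 y -> bilin (G y) (V y) (V y) = -1 /\ V y *m 'J phi y = 0].
Proof.
move=> Ux; have [T0 T0J T0neg] := exists_timelike_vertical Ux.
have sub : subm_dom c d `<=` cimg c by move=> y [].
have oU : open (subm_dom c d) by exact: open_subm_dom.
have Gs := smooth_mx_sub sub (smooth_gmx gM ac).
have ps := smooth_local_rep ac ad.
have pU y (Uy : subm_dom c d y) := local_rep_cimg Uy.
have hs := smooth_gmx gB ad.
have Gu := dom_gmx_unit.
have co := submersion_cometric.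
exact: (exists_unit_vertical_field oU Gs Gu ps pU hs co Ux T0J T0neg).
Qed.

End AtPoint.
End Submersion.

(** * The squared norm of the acceleration of the fibres as a function on M *)

Section GlobalFunction.
Variables (R : realType) (n : nat) (B : manifold R n) (M : manifold R n.+1).
Variables (gB : metric B) (gM : metric M) (pi : M -> B).
Hypothesis B_riemannian : riemannian gB.
Hypothesis M_index1 : metric_index gM 1.
Hypothesis pi_subm : semi_riemannian_submersion gM gB pi.

Implicit Types (c : chart R M n.+1) (d : chart R B n) (p : M).

Definition unit_vertical c d y (T : 'rV[R]_n.+1) : Prop :=
  bilin (gmx gM c y) T T = -1 /\ T *m 'J (local_rep pi c d) y = 0.

Definition accel_sq c d y T : R :=
  let a := fibre_accel (gmx gM c) (local_rep pi c d) T y in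
  bilin (gmx gB d (local_rep pi c d y)) a a.

Lemma unit_vertical_neq0 c d y T : unit_vertical c d y T -> T != 0.
Proof.
move=> [TT _]; apply/eqP => T0; move: TT; rewrite T0 bilin0l => /eqP.
by rewrite eq_sym oppr_eq0 oner_eq0.
Qed.

(** The two unit vectors agree up to sign, and the acceleration is quadratic. *)
Lemma accel_sq_vertical_eq c d y T S : atlas c -> atlas d -> subm_dom pi c d y ->
  unit_vertical c d y T -> unit_vertical c d y S -> accel_sq c d y S = accel_sq c d y T.
Proof.
move=> ac ad Uy uT [SS SJ]; have [TT TJ] := uT.
have [a SE] := fibre_one_dimensional pi_subm ac ad Uy TJ (unit_vertical_neq0 uT) SJ.
have a2 : a * a = 1.
  by move: SS; rewrite SE bilinZl bilinZr TT mulrA mulrN1 => /oppr_inj.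
have ps := smooth_local_rep pi_subm ac ad.
have oU : open (subm_dom pi c d) by exact: (open_subm_dom pi_subm).
rewrite /accel_sq; suff -> : fibre_accel (gmx gM c) (local_rep pi c d) S y =
    fibre_accel (gmx gM c) (local_rep pi c d) T y by [].
have gE : gamma (gmx gM c) y S S = gamma (gmx gM c) y T T.
  apply/rowP => k; rewrite !mxE; apply: eq_bigr => i _; apply: eq_bigr => j _.
  rewrite SE !mxE; transitivity ((a * a) * (christoffel (gmx gM c) y k i j * T 0 i * T 0 j)).
    by ring.
  by rewrite a2 mul1r.
have Jd := smooth_mx_differentiable (smooth_jacobian oU ps) Uy.
have DE : 'D_S ('D_S (local_rep pi c d)) y = 'D_T ('D_T (local_rep pi c d)) y.
  apply: etrans (esym (mulmx_derive_jacobian oU ps S S Uy)) _.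
  apply: etrans (mulmx_derive_jacobian oU ps T T Uy).
  by rewrite SE (derive_scaled_dir a T Jd) -scalemxAl -scalemxAr scalerA a2 scale1r.
by apply: (congr2 (fun u v : 'rV[R]_n => u - v)); [rewrite gE|exact: DE].
Qed.

Lemma accel_sq_invariant c c' d d' p T T' :
  chart_at c p -> chart_at c' p -> chart_at d (pi p) -> chart_at d' (pi p) ->
  unit_vertical c d (cto c p) T -> unit_vertical c' d' (cto c' p) T' ->
  accel_sq c' d' (cto c' p) T' = accel_sq c d (cto c p) T.
Proof.
move=> [ac cp] [ac' cp'] [ad dp] [ad' dp'] [TT TJ] uT'.
pose A := cdom c' `&` (pi @^-1` cdom d `&` pi @^-1` cdom d').
pose U := chart_image c A.
have oA : open A.
  by apply: openI; [exact: open_cdom|apply: openI; exact: (open_pi_cdom pi_subm)].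
have oU : open U by exact: open_chart_image.
have Ux : U (cto c p) by apply: chart_image_cto.
have tE y : U y -> cfrom c' (transition c c' y) = cfrom c y.
  by move=> [cy [c'y _]]; rewrite /transition /= ctoK.
have taus : smooth_mx U (transition c c').
  by apply: smooth_mx_sub (smooth_transition ac ac') => y [cy [c'y _]].
have tauU y : U y -> subm_dom pi c' d' (transition c c' y).
  move=> Uy; have [cy [c'y [dy d'y]]] := Uy; split; first exact: cto_img.
  by rewrite tE.
have Gs : smooth_mx U (gmx gM c).
  by apply: smooth_mx_sub (smooth_gmx gM ac) => y [].
have Gsym y : U y -> (gmx gM c y)^T = gmx gM c y by move=> [cy _]; exact: gmx_sym.
have Gu y : U y -> gmx gM c y \in unitmx by move=> [cy _]; exact: gmx_nondegenerate.
have G1s : smooth_mx (subm_dom pi c' d') (gmx gM c').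
  by apply: smooth_mx_sub (smooth_gmx gM ac') => y [].
have G1sym y : subm_dom pi c' d' y -> (gmx gM c' y)^T = gmx gM c' y.
  by move=> [cy _]; exact: gmx_sym.
have G1u y : subm_dom pi c' d' y -> gmx gM c' y \in unitmx.
  by move=> [cy _]; exact: gmx_nondegenerate.
have GE y : U y -> gmx gM c y = 'J (transition c c') y *m gmx gM c' (transition c c' y)
    *m ('J (transition c c') y)^T.
  by move=> [cy [c'y _]]; apply: gmx_transition => //; rewrite overlapE.
have phis : smooth_mx U (local_rep pi c d).
  by apply: smooth_mx_sub (smooth_local_rep pi_subm ac ad) => y [cy [_ []]].
have phi1s := smooth_local_rep pi_subm ac' ad'.
have phiW y : U y -> chart_image d (cdom d') (local_rep pi c d y).
  by move=> [cy [_ [dy d'y]]]; split; [exact: cto_img|rewrite /local_rep /= ctoK].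
have sigmas := smooth_transition ad ad'.
have phiE y : U y -> local_rep pi c' d' (transition c c' y) =
    transition d d' (local_rep pi c d y).
  move=> Uy; have [cy [_ [dy d'y]]] := Uy.
  by rewrite {1}/local_rep /= tE// /transition /local_rep /= ctoK.
have oU1 : open (subm_dom pi c' d') by exact: (open_subm_dom pi_subm).
have oW : open (chart_image d (cdom d')) by apply: open_chart_image; exact: open_cdom.
have tx : transition c c' (cto c p) = cto c' p by rewrite /transition /= ctoK.
have Ux' := tauU _ Ux; rewrite tx in Ux'.
have Aeq := fibre_accel_transition oU oU1 oW taus tauU Gs Gsym Gu G1s G1sym G1u GE
  phis phiW phi1s sigmas phiE Ux TJ.
have Jsq := jacobian_square oU taus tauU phis phiW phi1s sigmas phiE Ux.
pose S := T *m 'J (transition c c') (cto c p).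
have uS : unit_vertical c' d' (cto c' p) S.
  split; first by rewrite -TT GE// bilin_congr tx.
  by rewrite /S -tx -mulmxA Jsq mulmxA TJ mul0mx.
rewrite (accel_sq_vertical_eq ac' ad' Ux' uS uT') /accel_sq.
rewrite -{2 3}tx Aeq -[X in gmx gB d' (local_rep _ _ _ X)]tx.
rewrite phiE// -bilin_congr -(gmx_transition gB ad ad')// overlapE.
exact: phiW.
Qed.

Definition accel_sq_spec p : set R := [set r | exists c d T,
  [/\ chart_at c p, chart_at d (pi p), unit_vertical c d (cto c p) T &
      r = accel_sq c d (cto c p) T]].

(** The value is the same for all choices of charts and unit vertical vector by
    [accel_sq_invariant]; existence of the charts and of the vector is shown
    where the function is computed. *)
Definition accel_sq_at p : R := xget 0 (accel_sq_spec p).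

Lemma accel_sq_atE c d p T : chart_at c p -> chart_at d (pi p) ->
  unit_vertical c d (cto c p) T -> accel_sq_at p = accel_sq c d (cto c p) T.
Proof.
move=> cp dp uT.
have : accel_sq_spec p (accel_sq_at p).
  by apply: xgetPex; exists (accel_sq c d (cto c p) T), c, d, T.
move=> [c' [d' [T' [cp' dp' uT' ->]]]].
exact: (accel_sq_invariant cp cp' dp dp' uT uT').
Qed.

(** Near any point, the global function is |nabla_V V| ^ 2 for one smooth field V
    in one chart, which gives both its continuity and its derivatives. *)
Lemma accel_sq_at_field c d U0 V : atlas c -> atlas d -> open U0 ->
  U0 `<=` subm_dom pi c d -> smooth_mx U0 V ->
  (forall y, U0 y -> unit_vertical c d y (V y)) ->
  forall y, U0 y -> accel_sq_at (cfrom c y) =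
    bilin (gmx gM c y) (field_accel (gmx gM c) V y) (field_accel (gmx gM c) V y).
Proof.
move=> ac ad oU0 U0U Vs uV y U0y; have Uy := U0U y U0y.
have [cy dy] := dom_chart_at ac ad Uy.
have yK : cto c (cfrom c y) = y by rewrite cfromK//; case: Uy.
have uVy : unit_vertical c d (cto c (cfrom c y)) (V y) by rewrite yK; exact: uV.
rewrite (accel_sq_atE cy dy uVy) yK; apply: esym.
have sub : subm_dom pi c d `<=` cimg c by move=> z [].
have Gs := smooth_mx_sub sub (smooth_gmx gM ac).
have Gsym z (Uz : subm_dom pi c d z) := dom_gmx_sym gM ac Uz.
have Gu z (Uz : subm_dom pi c d z) := dom_gmx_unit gM ac Uz.
have ps := smooth_local_rep pi_subm ac ad.
have co z (Uz : subm_dom pi c d z) := submersion_cometric pi_subm ac ad Uz.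
have fib z (Uz : subm_dom pi c d z) := fibre_one_dimensional pi_subm ac ad Uz.
have Vu z (U0z : U0 z) := (uV z U0z).1.
have VJ z (U0z : U0 z) := (uV z U0z).2.
exact: (field_accel_norm Gs Gsym Gu ps co fib oU0 U0U Vs Vu VJ U0y).
Qed.

Lemma atlas_at m (N : manifold R m) (q : N) : exists c : chart R N m, chart_at c q.
Proof. by have [c ac cq] := atlas_covers q; exists c. Qed.

Lemma accel_sq_at_continuous : continuous accel_sq_at.
Proof.
move=> p; have [c [ac cp]] := atlas_at p; have [d [ad dp]] := atlas_at (pi p).
have Ux : subm_dom pi c d (cto c p) by apply: chart_image_cto.
have [U0 [V [oU0 U0U U0x Vs uV]]] :=
  exists_dom_unit_vertical_field B_riemannian M_index1 pi_subm ac ad Ux.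
have fE := accel_sq_at_field ac ad oU0 U0U Vs uV.
have sub : U0 `<=` cimg c by move=> z /U0U [].
have Gs := smooth_mx_sub sub (smooth_gmx gM ac).
have Gu z (U0z : U0 z) := dom_gmx_unit gM ac (U0U z U0z).
have Ns := smooth_field_accel oU0 Gs Gu Vs.
pose N := field_accel (gmx gM c) V.
pose F z := bilin (gmx gM c z) (N z) (N z).
have Fc : {for cto c p, continuous F}.
  exact: (smoothf_bilin oU0 Gs Ns Ns 0%N).
have FE : \forall q \near p, F (cto c q) = accel_sq_at q.
  have cp_nbhs : nbhs p (cdom c).
    by apply: open_nbhs_nbhs; split => //; exact: open_cdom.
  have U0_nbhs : nbhs p (cto c @^-1` U0).
    by apply: (cto_continuous cp); exact: open_nbhs_nbhs.
  apply: filterS (filterI cp_nbhs U0_nbhs) => q [cq U0q].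
  by have := fE _ U0q; rewrite ctoK// => ->.
have Fp : F (cto c p) = accel_sq_at p := nbhs_singleton FE.
have Fcp : (fun q => F (cto c q)) @ p --> F (cto c p).
  exact: (@continuous_comp _ _ _ (cto c) F p (cto_continuous cp) Fc).
rewrite /continuous_at -Fp; exact: cvg_trans (near_eq_cvg FE) Fcp.
Qed.

(** The plane spanned by X and V has negative Gram determinant, so the numerator
    of a positive sectional curvature is negative. *)
Lemma mixed_curvature_neg c d y U0 V w : atlas c -> atlas d ->
  positive_mixed_curvature gM pi -> U0 `<=` subm_dom pi c d -> U0 y ->
  unit_vertical c d y (V y) -> w != 0 ->
  bilin (gmx gM c y) (curvature_at (gmx gM c) y
      (hlift (gmx gM c) (local_rep pi c d) (gmx gB d) w y) (V y) (V y))
    (hlift (gmx gM c) (local_rep pi c d) (gmx gB d) w y) < 0.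
Proof.
move=> ac ad Kpos U0U U0y uV w0; set X := hlift _ _ _ _ _.
have Uy := U0U y U0y.
have [cy dy] := dom_chart_at ac ad Uy; have [VV VJ] := uV.
have yK : cto c (cfrom c y) = y by rewrite cfromK//; case: Uy.
have Gu z (Uz : subm_dom pi c d z) := dom_gmx_unit gM ac Uz.
have co z (Uz : subm_dom pi c d z) := submersion_cometric pi_subm ac ad Uz.
have XV v : v *m 'J (local_rep pi c d) y = 0 -> bilin (gmx gM c y) X v = 0.
  exact: (hlift_orthogonal (gmx gB d) Gu w Uy).
have XX : bilin (gmx gM c y) X X = bilin (gmx gB d (local_rep pi c d y)) w w.
  exact: (bilin_hlift Gu co w w Uy).
have XXpos : 0 < bilin (gmx gM c y) X X.
  by rewrite XX; apply: gmx_pos => //; exact: local_rep_cimg Uy.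
have X0 : X != 0 by apply/eqP => X0; move: XXpos; rewrite X0 bilin0l ltxx.
have Xh : horizontal gM pi c (cfrom c y) X.
  move=> v /(_ d dy); rewrite /differential yK => vJ.
  by rewrite /metric_at yK; exact: XV.
have Vv : vertical pi c (cfrom c y) (V y).
  by apply: (verticalE pi_subm cy dy); rewrite yK.
have := Kpos c _ cy X (V y) Xh Vv X0 (unit_vertical_neq0 uV).
rewrite yK /sectional VV (XV _ VJ) expr0n /= subr0 mulrN1 invrN mulrN oppr_gt0.
by rewrite pmulr_llt0 ?invr_gt0.
Qed.

End GlobalFunction.

Theorem theorem2p5 (R : realType) (n : nat) (n_ge1 : (1 <= n)%N)
    (B : manifold R n) (gB : metric B) (B_riemannian : riemannian gB)
    (M : manifold R n.+1) (gM : metric M) (M_compact : compact [set: M])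
    (M_orientable : orientable M) (M_index1 : metric_index gM 1) :
  ~ exists pi : M -> B,
      semi_riemannian_submersion gM gB pi /\ positive_mixed_curvature gM pi.
Proof.
move=> [pi [pi_subm Kpos]].
pose f := accel_sq_at gB gM pi.
have fc : continuous f by exact: accel_sq_at_continuous.
have [p _ pmax] := compact_EVT_max (mfd_nonempty M) M_compact (continuous_subspaceT fc).
have [c [ac cp]] := atlas_at p; have [d [ad dp]] := atlas_at (pi p).
have Ux : subm_dom pi c d (cto c p) by apply: chart_image_cto.
have [U0 [V [oU0 U0U U0x Vs uV]]] :=
  exists_dom_unit_vertical_field B_riemannian M_index1 pi_subm ac ad Ux.
have fE := accel_sq_at_field pi_subm ac ad oU0 U0U Vs uV.
have sub : subm_dom pi c d `<=` cimg c by move=> z [].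
have Gs := smooth_mx_sub sub (smooth_gmx gM ac).
have Gsym z (Uz : subm_dom pi c d z) := dom_gmx_sym gM ac Uz.
have Gu z (Uz : subm_dom pi c d z) := dom_gmx_unit gM ac Uz.
have ps := smooth_local_rep pi_subm ac ad.
have pU z (Uz : subm_dom pi c d z) := local_rep_cimg Uz.
have hs := smooth_gmx gB ad.
have hpos z (dz : cimg d z) u := gmx_pos B_riemannian ad dz (u := u).
have co z (Uz : subm_dom pi c d z) := submersion_cometric pi_subm ac ad Uz.
have fib z (Uz : subm_dom pi c d z) := fibre_one_dimensional pi_subm ac ad Uz.
have Vu z (U0z : U0 z) := (uV z U0z).1.
have VJ z (U0z : U0 z) := (uV z U0z).2.
pose w1 : 'rV[R]_n := const_mx 1.
have w10 : w1 != 0.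
  apply/eqP => /rowP /(_ (Ordinal n_ge1)) /eqP; by rewrite !mxE oner_eq0.
apply: (accel_max_impossible Gs Gsym Gu ps pU hs hpos co fib oU0 U0U Vs Vu VJ U0x w10).
  move=> y U0y; rewrite -(fE y U0y) -(fE _ U0x); apply: le_trans (pmax _ _) _.
    by rewrite inE.
  by rewrite ctoK.
move=> w w0; exact: (mixed_curvature_neg B_riemannian pi_subm ac ad Kpos U0U U0x (uV _ U0x) w0).
Qed.
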